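(* Let $\dim V=(n|m)$ and $h\ge 0$ an integer. The element $$\sum_{L}(-1)^{\alpha(L,L)+p(L)}\,e_s\big(v^*_{I_h}\otimes v^*_L\big)\otimes\tilde e_t\big(v_L\otimes v_{J_h}\big)\in V^{*\otimes (m+h)n}\otimes V^{\otimes(n+h)m}=\hat T^{(m+h)n,(n+h)m}(V),$$ where $L$ runs over all sequences of length $nm$ with entries in $R_V$, is $\mathfrak{sl}(V)$-invariant. (This element is $e_s\times\tilde e_t(v^*_{I_h}\otimes\hat\theta_{nm}\otimes v_{J_h})$, with $\hat\theta_{nm}=\sum_L(-1)^{\alpha(L,L)+p(L)}v^*_L\otimes v_L$.)
   Context: $V$ has homogeneous basis $e_i$, $i\in R_V=\{1,\dots,n,\bar1,\dots,\bar m\}$ (barred indices odd), $e_i^*$ the left dual basis. For a sequence $I$, $v_I=e_{i_1}\otimes\dots\otimes e_{i_N}$, $v^*_I=e^*_{i_1}\otimes\dots\otimes e^*_{i_N}$; $p(L)=\sum p(l_i)$, $\alpha(L,L)=\sum_{i<j}p(l_i)p(l_j)$. $\mathfrak S_N$ acts on $X^{\otimes N}$ ($X=V$ or $V^*$) by $\sigma v_I=c(I,\sigma^{-1})v_{\sigma I}$, where $\mathfrak S_N$ permutes positions of sequences and $c(I,\sigma)=\pm1$ is defined by $x_{\sigma^{-1}I}=c(I,\sigma)x_I$ in the free supercommutative algebra on generators $x_i$ of parity $p(i)$. For a tableau $t$ with row/column stabilizers $R_t,C_t$: $e_t=\sum_{\tau\in C_t,\sigma\in R_t}\varepsilon(\tau)\sigma\tau$,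 $\tilde e_t=\sum_{\tau\in C_t,\sigma\in R_t}\varepsilon(\tau)\tau\sigma$. $t$: tableau of rectangular shape with $n+h$ rows and $m$ columns; its first $n$ rows form $t_1$, filled with $1,\dots,nm$ consecutively column by column, its last $h$ rows form $t_2$, filled with $nm+1,\dots,nm+hm$ consecutively column by column. $s$: tableau with $n$ rows and $h+m$ columns; its first $h$ columns $s_1$ are filled with $1,\dots,hn$ consecutively column by column, its last $m$ columns $s_2$ with $hn+1,\dots,hn+mn$ consecutively column by column. $I_h$: the sequence $1,2,\dots,n$ repeated $h$ times; $J_h$: $h$ copies of $\bar1$, then $h$ copies of $\bar 2$, ..., then $h$ copies of $\bar m$. $e_s$ acts on the $V^*$-factors, $\tilde e_t$ on the $V$-factors. *)

(* Defs.v *)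
From mathcomp Require Import all_boot all_order all_algebra all_fingroup.
Set Implicit Arguments. Unset Strict Implicit. Unset Printing Implicit Defensive.
Import GRing.Theory.

(* The index set R_V = {1..n} ∪ {1bar..mbar}: inl i = even index i+1,
   inr j = odd index (j+1)bar.  Indices are 0-based in Rocq. *)
Notation idx n m := ('I_n + 'I_m)%type.

Section Super.
Variables (R : fieldType) (n m : nat).

Definition par (i : idx n m) : bool := if i is inr _ then true else false.

(* A sequence of length N with entries in R_V is an N.-tuple; an element of
   X^{\otimes N} (X = V or its dual) is given by its coordinates in the basis v_I
   (resp. v^*_I), i.e. a function N.-tuple -> R. *)
Definition delta N (I : N.-tuple (idx n m)) : N.-tuple (idx n m) -> R :=
  fun I' => (if I' == I then 1 else 0)%R.

Definition perm_seq N (s : 'S_N) (I : N.-tuple (idx n m)) : N.-tuple (idx n m) :=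
  [tuple tnth I ((s^-1)%g j) | j < N].

(* c(I,sigma): x_{sigma^{-1} I} = x_{I_{sigma 1}} ... x_{I_{sigma N}} = c(I,sigma) x_I
   in the free supercommutative algebra, i.e. the Koszul sign counting
   inversions of sigma between positions carrying odd letters. *)
Definition kcount N (I : N.-tuple (idx n m)) (s : 'S_N) : nat :=
  #|[set jj : 'I_N * 'I_N | [&& (jj.1 < jj.2)%N, (s jj.2 < s jj.1)%N,
                              par (tnth I (s jj.1)) & par (tnth I (s jj.2))]]|.
Definition csign N (I : N.-tuple (idx n m)) (s : 'S_N) : R := ((-1) ^+ kcount I s)%R.

Definition pact N (s : 'S_N) (T : N.-tuple (idx n m) -> R) : N.-tuple (idx n m) -> R :=
  fun J => (\sum_(I : N.-tuple (idx n m))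
             (if perm_seq s I == J then csign I (s^-1)%g else 0) * T I)%R.

(* Row / column stabilizers of a tableau with entries 0..N-1, described by
   the row and column of each entry. *)
Definition stab N (pos : 'I_N -> nat) : {set 'S_N} :=
  [set s : 'S_N | [forall x, pos (s x) == pos x]].

Definition youngE N (row col : 'I_N -> nat) (T : N.-tuple (idx n m) -> R)
  : N.-tuple (idx n m) -> R :=
  fun J => (\sum_(tau in stab col) \sum_(sg in stab row)
             (-1) ^+ odd_perm tau * pact sg (pact tau T) J)%R.

Definition youngE' N (row col : 'I_N -> nat) (T : N.-tuple (idx n m) -> R)
  : N.-tuple (idx n m) -> R :=
  fun J => (\sum_(tau in stab col) \sum_(sg in stab row)
             (-1) ^+ odd_perm tau * pact tau (pact sg T) J)%R.

Variable h : nat.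

(* Tableau s: n rows, h+m columns; s_1 (first h columns) filled with
   entries 0..hn-1 column by column, s_2 (last m columns) with hn..hn+mn-1
   column by column.  Total number of boxes (m+h)n = h*n + n*m. *)
Definition row_s (x : 'I_(h * n + n * m)) : nat :=
  (if x < h * n then x %% n else (x - h * n) %% n)%N.
Definition col_s (x : 'I_(h * n + n * m)) : nat :=
  (if x < h * n then x %/ n else h + (x - h * n) %/ n)%N.

(* Tableau t: n+h rows, m columns; t_1 (first n rows) filled with 0..nm-1
   column by column, t_2 (last h rows) with nm..nm+hm-1 column by column.
   Total number of boxes (n+h)m = n*m + h*m. *)
Definition row_t (x : 'I_(n * m + h * m)) : nat :=
  (if x < n * m then x %% n else n + (x - n * m) %% h)%N.
Definition col_t (x : 'I_(n * m + h * m)) : nat :=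
  (if x < n * m then x %/ n else (x - n * m) %/ h)%N.

Definition Ih_seq : seq (idx n m) :=
  flatten (nseq h [seq @inl 'I_n 'I_m i | i <- enum 'I_n]).
Lemma size_Ih : size Ih_seq == h * n.
Proof.
rewrite /Ih_seq size_flatten /shape map_nseq size_map size_enum_ord.
by rewrite sumn_nseq mulnC.
Qed.
Definition Ih : (h * n).-tuple (idx n m) := Tuple size_Ih.

Definition Jh_seq : seq (idx n m) :=
  flatten [seq nseq h (@inr 'I_n 'I_m j) | j <- enum 'I_m].
Lemma size_Jh : size Jh_seq == h * m.
Proof.
rewrite /Jh_seq -[X in h * X]size_enum_ord.
elim: (enum 'I_m) => [|x s IH] /=; first by rewrite muln0.
by rewrite size_cat size_nseq (eqP IH) mulnS.
Qed.
Definition Jh : (h * m).-tuple (idx n m) := Tuple size_Jh.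

Definition pL N (L : N.-tuple (idx n m)) : nat := count par L.
Definition alphaL N (L : N.-tuple (idx n m)) : nat :=
  #|[set ij : 'I_N * 'I_N | [&& (ij.1 < ij.2)%N, par (tnth L ij.1) & par (tnth L ij.2)]]|.

Definition theta_elt (I : (h * n + n * m).-tuple (idx n m))
                     (J : (n * m + h * m).-tuple (idx n m)) : R :=
  (\sum_(L : (n * m).-tuple (idx n m))
     (-1) ^+ (alphaL L + pL L)%N *
     youngE row_s col_s (delta (cat_tuple Ih L)) I *
     youngE' row_t col_t (delta (cat_tuple L Jh)) J)%R.

End Super.

Section LieAction.
Variables (R : fieldType) (n m : nat).

Definition replace N (I : N.-tuple (idx n m)) (k : 'I_N) (x : idx n m)
  : N.-tuple (idx n m) := [tuple if j == k then x else tnth I j | j < N].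

Definition par_before N (I : N.-tuple (idx n m)) (k : nat) : nat :=
  \sum_(j < N | (j < k)%N) par (tnth I j).

(* Action of the matrix unit E_{ab} (E_{ab} e_c = delta_{bc} e_a, parity
   p(a)+p(b)) on the basis vector v^*_I (x) v_J of V^{*(x)A} (x) V^{(x)B}:
   super Leibniz rule, with the dual action
   (E f)(v) = -(-1)^{p(E)p(f)} f(E v), so E_{ab} e_c^* = -(-1)^{p(E)p(a)} delta_{ca} e_b^*.
   Result given by its coordinates at (I', J'). *)
Definition Eact A B (a b : idx n m) (I : A.-tuple (idx n m)) (J : B.-tuple (idx n m))
  (I' : A.-tuple (idx n m)) (J' : B.-tuple (idx n m)) : R :=
  let pE : nat := par a (+) par b in
  (\sum_(k < A)
     (if tnth I k == a then
        (-1) ^+ (pE * par_before I k)%N * (- (-1) ^+ (pE * par a)%N) *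
        (if (I' == replace I k b) && (J' == J) then 1 else 0)
      else 0)
  + \sum_(k < B)
     (if tnth J k == b then
        (-1) ^+ (pE * (count (@par n m) I + par_before J k))%N *
        (if (I' == I) && (J' == replace J k a) then 1 else 0)
      else 0))%R.

Definition glact A B (X : idx n m -> idx n m -> R)
  (w : A.-tuple (idx n m) -> B.-tuple (idx n m) -> R)
  (I' : A.-tuple (idx n m)) (J' : B.-tuple (idx n m)) : R :=
  (\sum_(a : idx n m) \sum_(b : idx n m) X a b *
    \sum_(I : A.-tuple (idx n m)) \sum_(J : B.-tuple (idx n m))
       w I J * Eact a b I J I' J')%R.

Definition supertrace (X : idx n m -> idx n m -> R) : R :=
  (\sum_(a : idx n m) (-1) ^+ par a * X a a)%R.

End LieAction.

(* Main.v *)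
Require Import Defs.
From mathcomp Require Import all_boot all_order all_algebra all_fingroup.
From mathcomp Require Import mpoly.

(* Write g = gl(V) = g_{-1} + g_0 + g_1, where g_1 is spanned by the E_ab with a
   even and b odd.  The action of g commutes with the symmetric groups and
   theta-hat is g-invariant, so applying E_ab to the element w of the theorem
   only moves letters of I_h (a -> b) and of J_h (b -> a).
   - If a is odd and b even, nothing can be moved.
   - If a and b are distinct of the same parity, a column of s_1 gets two equal
     even letters, or a row of t_2 gets two equal odd letters, and the Young
     operator kills the result.
   - E_aa multiplies w by -h (a even) or h (a odd), which sums up to the
     supertrace.
   - For x in g_1, put u = x w.  By the previous cases g_{-1} u = 0.  Let u_k be
     the component of u with k odd letters in the V^*-factors.  The V-part of
     u_0 has nm + 1 even letters, hence two equal ones in some column of t, so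
     u_0 = 0.  If u_{k-1} = 0, then g_{-1} acting on the V^*-factors alone kills
     u_k; as u_k is symmetric in each of the n rows of s, a generic n x n matrix
     argument gives u_k = 0 for k > 0. *)

Set Implicit Arguments.
Unset Strict Implicit.
Unset Printing Implicit Defensive.
Import GRing.Theory.

(** * Parities of inversions between marked positions, the source of all Koszul signs *)

Section Inversions.
Variable N : nat.
Implicit Types (g : 'S_N) (q : 'I_N -> bool).

Lemma ltn_ordN (x y : 'I_N) : x != y -> (y < x)%N = ~~ (x < y)%N.
Proof.
by rewrite -val_eqE /= => xy; rewrite -leqNgt (leq_eqVlt y) eq_sym (negPf xy).
Qed.

(** The terms at [(i, j)] and [(j, i)] cancel modulo 2, and the diagonal is zero. *)
Lemma xor_sym2 (f : 'I_N -> 'I_N -> bool) :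
  (forall i j, f i j = f j i) -> (forall i, f i i = false) ->
  \big[addb/false]_i \big[addb/false]_j f i j = false.
Proof.
move=> fC f0.
transitivity (\big[addb/false]_i \big[addb/false]_j (f i j && (i < j)) (+)
  \big[addb/false]_i \big[addb/false]_j (f i j && (j < i))).
  rewrite -big_split; apply: eq_bigr => i _; rewrite -big_split.
  apply: eq_bigr => j _ /=.
  by case: ltngtP => [||/val_inj ->]; rewrite ?f0 //; case: (f _ _).
rewrite [X in _ (+) X]exchange_big /=.
under [X in _ (+) X]eq_bigr do under eq_bigr do rewrite fC.
exact: addbb.
Qed.

Lemma odd_sum (T : finType) (P : pred T) (F : T -> nat) :
  odd (\sum_(i | P i) F i) = \big[addb/false]_(i | P i) odd (F i).
Proof. exact: (big_morph odd oddD). Qed.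

Lemma andb_xor (T : finType) (b : bool) (F : T -> bool) :
  b && \big[addb/false]_i F i = \big[addb/false]_i (b && F i).
Proof. exact: (big_morph (andb b) (andb_addr b) (andbF b)). Qed.

Lemma xor_pick (T : finType) (k : T) (F : T -> bool) :
  \big[addb/false]_i ((i == k) && F i) = F k.
Proof.
rewrite (bigD1 k) //= eqxx big1 ?addbF // => i /negPf -> //.
Qed.

(** The exponent of the Koszul sign of [g] modulo 2, with [q] marking the positions of odd letters.
    Boolean values let sign identities be settled by case analysis. *)
Definition invb g q : bool :=
  \big[addb/false]_(i : 'I_N) \big[addb/false]_(j : 'I_N)
    [&& (i < j)%N, (g j < g i)%N, q i & q j].

(** The sign exponent that an odd operator collects on its way to position [k]. *)
Definition beforeb q (k : 'I_N) : bool :=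
  \big[addb/false]_(j : 'I_N) ((j < k)%N && q j).

Lemma eq_invb g q q' : q =1 q' -> invb g q = invb g q'.
Proof.
by move=> qq; apply: eq_bigr => i _; apply: eq_bigr => j _; rewrite !qq.
Qed.

Lemma invb_fix g q : (forall i, q i -> g i = i) -> invb g q = false.
Proof.
move=> gq; rewrite /invb big1 // => i _; rewrite big1 // => j _.
apply/negP => /and4P[ij gji qi qj]; move: gji; rewrite !gq //.
by rewrite ltnNge ltnW.
Qed.

(** The cocycle identity of the Koszul sign. After transporting the last term back along [g], the
    three summands together form a function symmetric in [i] and [j], so [xor_sym2] applies. *)
Lemma invb_mul g g' q :
  invb (g * g') q = invb g q (+) invb g' (fun i => q ((g^-1)%g i)).
Proof.
have -> : invb g' (fun i => q ((g^-1)%g i)) =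
    \big[addb/false]_(i : 'I_N) \big[addb/false]_(j : 'I_N)
      [&& (g i < g j)%N, (g' (g j) < g' (g i))%N, q i & q j].
  rewrite /invb (reindex_inj (@perm_inj _ g)); apply: eq_bigr => i _.
  rewrite (reindex_inj (@perm_inj _ g)); apply: eq_bigr => j _.
  by rewrite !permK.
apply/eqP; rewrite -negb_add; apply/negbT.
rewrite /invb -!big_split /=.
under eq_bigr do rewrite -!big_split.
apply: xor_sym2 => [i j|i] /=; last by rewrite !ltnn.
rewrite !permM.
have [->|ij] := eqVneq i j; first by [].
rewrite (@ltn_ordN i j) // (@ltn_ordN (g i) (g j)) ?(inj_eq perm_inj) //.
rewrite (@ltn_ordN (g' (g i)) (g' (g j))) ?(inj_eq perm_inj) //.
by case: (i < j)%N; case: (g i < g j)%N; case: (g' _ < _)%N; case: (q i); case: (q j).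
Qed.

(** Toggling the mark at [K] changes the count by the inversions through [K]. The marked positions
    before [K] and those sent before [g K] differ exactly in these inversions. *)
Lemma invb_flip g q q' (K : 'I_N) :
  (forall i, i != K -> q' i = q i) ->
  invb g q' = invb g q (+)
    ((q' K (+) q K) && (beforeb q K (+) beforeb (fun i => q ((g^-1)%g i)) (g K))).
Proof.
move=> qq'; set e := _ (+) q K.
have q'E i : q' i = q i (+) ((i == K) && e).
  by have [->|/qq' ->] := eqVneq i K; rewrite ?addbF // /e addbC addbK.
have -> : beforeb (fun i => q ((g^-1)%g i)) (g K) =
    \big[addb/false]_(j : 'I_N) ((g j < g K)%N && q j).
  rewrite /beforeb (reindex_inj (@perm_inj _ g)).
  by apply: eq_bigr => j _; rewrite permK.
have -> : e && (beforeb q K (+) \big[addb/false]_(j : 'I_N) ((g j < g K)%N && q j)) =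
  (\big[addb/false]_(i : 'I_N) \big[addb/false]_(j : 'I_N)
    [&& i == K, (i < j)%N, (g j < g i)%N, e & q j]) (+)
  (\big[addb/false]_(i : 'I_N) \big[addb/false]_(j : 'I_N)
    [&& j == K, (i < j)%N, (g j < g i)%N, e & q i]).
  under [X in _ = X (+) _]eq_bigr do rewrite -andb_xor.
  rewrite xor_pick [X in _ = _ (+) X]exchange_big /=.
  under [X in _ = _ (+) X]eq_bigr do rewrite -andb_xor.
  rewrite xor_pick /beforeb -!big_split andb_xor.
  apply: eq_bigr => j _ /=.
  have [->|jK] := eqVneq j K; first by rewrite !ltnn !andbF.
  rewrite (@ltn_ordN j K) // (@ltn_ordN (g j) (g K)) ?(inj_eq perm_inj) //.
  by case: (j < K)%N; case: (g j < g K)%N; case: (q j); case: (e).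
rewrite /invb -!big_split; apply: eq_bigr => i _; rewrite -!big_split.
apply: eq_bigr => j _ /=; rewrite !q'E.
have [->|jK] := eqVneq i K; have [->|iK] := eqVneq j K; rewrite /= ?ltnn //;
by do 2!case: (_ < _)%N => //=; case: (e); case: (q _); case: (q _).
Qed.

(** If both positions are marked, unmark them, so that no marked position moves, and restore the
    marks with [invb_flip]. The resulting counts cancel except for the crossing of [i] with [j]. *)
Lemma invb_tperm i j q : i != j -> q i = q j -> invb (tperm i j) q = q i.
Proof.
move=> ij qij; case qi: (q i); last first.
  apply: invb_fix => x qx; rewrite tpermD //.
    by apply/eqP => xi; rewrite xi qx in qi.
  by apply/eqP => xi; rewrite qij xi qx in qi.
pose q1 x := (x != i) && q x; pose q2 x := (x != j) && q1 x.
rewrite (@invb_flip _ q1 q i) => [|x xi]; last by rewrite /q1 xi.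
rewrite (@invb_flip _ q2 q1 j) => [|x xi]; last by rewrite /q2 xi.
rewrite invb_fix => [|x /and3P[xj xi _]]; last by rewrite tpermD // eq_sym.
rewrite /q2 /q1 !eqxx qi /= (eq_sym j) ij -qij qi /= !tpermL !tpermR tpermV.
rewrite /beforeb -!big_split /=.
transitivity (\big[addb/false]_x (((x == i) && (i < j)%N) (+)
                                  ((x == j) && (j < i)%N))).
  apply: eq_bigr => x _; case: tpermP => [->|->|/eqP/negPf-> /eqP/negPf->] /=.
  - by rewrite !eqxx (negPf ij) -qij qi /= ltnn !andbF /= (eq_sym j) ij !andbT addbF.
  - by rewrite !eqxx eq_sym (negPf ij) -qij qi /= ltnn !andbF /= !andbT addbF.
  - by case: (x < i)%N; case: (x < j)%N; case: (q x).
by rewrite big_split /= !xor_pick (ltn_ordN ij); case: (i < j)%N.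
Qed.

(** A single odd letter travels from [i] to [j] and crosses the other odd letters in between. *)
Lemma invb_tperm_move i j q : i != j -> q i -> ~~ q j ->
  invb (tperm i j) q = beforeb (fun x => (x != i) && q x) i (+)
                       beforeb (fun x => (x != i) && q x) j.
Proof.
move=> ij qi qj; pose q1 x := (x != i) && q x.
rewrite (@invb_flip _ q1 q i) => [|x xi]; last by rewrite /q1 xi.
rewrite invb_fix => [|x /andP[xi qx]]; last first.
  by rewrite tpermD // eq_sym //; apply: contraNneq qj => <-.
rewrite /q1 eqxx qi /= tpermL tpermV; congr (_ (+) _).
apply: eq_bigr => x _; case: tpermP => // ->.
  by rewrite eqxx (negPf qj) !andbF.
by rewrite eqxx (negPf qj) !andbF.
Qed.


End Inversions.

(** * Permutations and matrix units acting on tensor coordinates *)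

Section TensorOperators.
Variables (R : fieldType) (n m : nat).
Local Open Scope ring_scope.
Notation letter := (idx n m).
Implicit Types (a b c d : letter).

Definition tpar N (I : N.-tuple letter) (j : 'I_N) : bool := par (tnth I j).

Lemma count_par_sum N (I : N.-tuple letter) :
  count (@par n m) I = (\sum_l tpar I l)%N.
Proof.
rewrite -sum1_count big_tuple big_mkcond; apply: eq_bigr => l _.
by rewrite /tpar; case: par.
Qed.

(** The inverse of [perm_seq s]; coordinates are pulled back along it. *)
Definition subst N (s : 'S_N) (I : N.-tuple letter) : N.-tuple letter :=
  [tuple tnth I (s j) | j < N].

Lemma tnth_subst N (s : 'S_N) (I : N.-tuple letter) j :
  tnth (subst s I) j = tnth I (s j).
Proof. exact: tnth_mktuple. Qed.

Lemma substM N (s t : 'S_N) (I : N.-tuple letter) :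
  subst t (subst s I) = subst (t * s)%g I.
Proof. by apply: eq_from_tnth => j; rewrite !tnth_subst permM. Qed.

Lemma subst1 N (I : N.-tuple letter) : subst 1%g I = I.
Proof. by apply: eq_from_tnth => j; rewrite tnth_subst perm1. Qed.

Lemma substK N (s : 'S_N) : cancel (@subst N s) (@subst N s^-1%g).
Proof. by move=> I; rewrite substM mulVg subst1. Qed.

Lemma perm_eq_subst N (s : 'S_N) (I : N.-tuple letter) : perm_eq (subst s I) I.
Proof. by apply/tuple_permP; exists s. Qed.

Lemma count_subst N (s : 'S_N) (I : N.-tuple letter) P :
  count P (subst s I) = count P I.
Proof. by apply/seq.permP; exact: perm_eq_subst. Qed.

(** Only the source sequence [subst s J] reaches [J], and its sign can be read off from the odd
    positions of the target. *)
Lemma pactE N (s : 'S_N) (T : N.-tuple letter -> R) (J : N.-tuple letter) :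
  pact s T J = (-1) ^+ invb s^-1%g (tpar J) * T (subst s J).
Proof.
rewrite /pact (bigD1 (subst s J)) //= big1 ?addr0 => [|I neI]; last first.
  case: eqP => [eJ|]; last by rewrite mul0r.
  case/eqP: neI; apply: eq_from_tnth => j.
  by rewrite tnth_subst -eJ tnth_mktuple permK.
have -> : perm_seq s (subst s J) == J.
  by apply/eqP/eq_from_tnth => j; rewrite tnth_mktuple tnth_subst permKV.
congr (_ * _); rewrite /csign -signr_odd; congr (_ ^+ nat_of_bool _).
rewrite /kcount -sum1_card big_mkcond odd_sum /= /invb.
rewrite pair_big /=; apply: eq_bigr => -[i j] _.
by rewrite inE /= !tnth_subst !permKV /tpar; case: ifP.
Qed.

Lemma eq_pact N (s : 'S_N) (T T' : N.-tuple letter -> R) :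
  T =1 T' -> pact s T =1 pact s T'.
Proof. by move=> TT J; rewrite !pactE TT. Qed.

Lemma pact_sum N (s : 'S_N) (K : finType) (P : pred K) (F : K -> N.-tuple letter -> R) J :
  pact s (fun I => \sum_(k | P k) F k I) J = \sum_(k | P k) pact s (F k) J.
Proof. by rewrite pactE mulr_sumr; apply: eq_bigr => k _; rewrite pactE. Qed.

Lemma pactZ N (s : 'S_N) x (T : N.-tuple letter -> R) J :
  pact s (fun I => x * T I) J = x * pact s T J.
Proof. by rewrite !pactE mulrCA. Qed.

(** The product [t * s] applies [t] first, so this is a left action; the signs match by the cocycle
    identity [invb_mul]. *)
Lemma pactM N (s t : 'S_N) (T : N.-tuple letter -> R) J :
  pact s (pact t T) J = pact (t * s)%g T J.
Proof.
rewrite !pactE mulrA -signr_addb substM invMg invb_mul; congr (_ * _).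
congr ((-1) ^+ nat_of_bool (_ (+) _)); apply: eq_invb => i.
by rewrite /tpar tnth_subst invgK.
Qed.

Lemma tnth_replace N (I : N.-tuple letter) k x j :
  tnth (replace I k x) j = if j == k then x else tnth I j.
Proof. exact: tnth_mktuple. Qed.

Lemma replace_replace N (I : N.-tuple letter) k x y :
  replace (replace I k x) k y = replace I k y.
Proof.
by apply: eq_from_tnth => j; rewrite !tnth_replace; case: eqP.
Qed.

Lemma replace_id N (I : N.-tuple letter) k : replace I k (tnth I k) = I.
Proof. by apply: eq_from_tnth => j; rewrite tnth_replace; case: eqP => [->|]. Qed.

Lemma replaceC N (I : N.-tuple letter) k l x y : k != l ->
  replace (replace I k x) l y = replace (replace I l y) k x.
Proof.
move=> kl; apply: eq_from_tnth => j; rewrite !tnth_replace.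
by have [->|//] := eqVneq j l; rewrite eq_sym (negPf kl).
Qed.

Lemma replace_swap N (I I' : N.-tuple letter) k a b :
  (tnth I k == a) && (I' == replace I k b) =
  (tnth I' k == b) && (I == replace I' k a).
Proof.
apply/andP/andP => -[/eqP <- /eqP ->];
by rewrite tnth_replace eqxx replace_replace replace_id.
Qed.

Lemma subst_replace N (s : 'S_N) (I : N.-tuple letter) k x :
  subst s (replace I (s k) x) = replace (subst s I) k x.
Proof.
apply: eq_from_tnth => j; rewrite tnth_subst !tnth_replace tnth_subst.
by rewrite (inj_eq perm_inj).
Qed.

Definition parE a b : bool := par a (+) par b.

(* [D a b] is the matrix unit [E_ab] acting on coordinates: it is the action on
   the factors [V], and the dual action on the factors [V^*] is a multiple of
   [D b a]. *)
Definition D N a b (T : N.-tuple letter -> R) (I : N.-tuple letter) : R :=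
  \sum_(k < N | tnth I k == a)
    (-1) ^+ (parE a b && beforeb (tpar I) k) * T (replace I k b).

Lemma odd_par_before N (I : N.-tuple letter) (k : 'I_N) :
  odd (par_before I k) = beforeb (tpar I) k.
Proof.
rewrite /par_before odd_sum big_mkcond /=; apply: eq_bigr => j _.
by rewrite /tpar; case: (j < k)%N => //=; case: par.
Qed.

Lemma beforeb_replace N (I : N.-tuple letter) k l x :
  beforeb (tpar (replace I k x)) l =
  beforeb (tpar I) l (+) ((k < l)%N && (par x (+) tpar I k)).
Proof.
rewrite -(xor_pick k (fun j => (j < l)%N && (par x (+) tpar I j))) -big_split.
apply: eq_bigr => j _ /=; rewrite /tpar tnth_replace.
by case: eqP => /= _; case: (j < l)%N; case: par => //=; case: par.
Qed.

Lemma eq_D N a b (T T' : N.-tuple letter -> R) : T =1 T' -> D a b T =1 D a b T'.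
Proof. by move=> TT I; apply: eq_bigr => k _; rewrite TT. Qed.

Lemma D_sum N a b (K : finType) (P : pred K) (F : K -> N.-tuple letter -> R) I :
  D a b (fun I => \sum_(k | P k) F k I) I = \sum_(k | P k) D a b (F k) I.
Proof.
rewrite /D exchange_big; apply: eq_bigr => k _.
by rewrite mulr_sumr.
Qed.

Lemma DZ N a b x (T : N.-tuple letter -> R) I :
  D a b (fun I => x * T I) I = x * D a b T I.
Proof. by rewrite /D mulr_sumr; apply: eq_bigr => k _; rewrite mulrCA. Qed.

Lemma DD N a b (T T' : N.-tuple letter -> R) I :
  D a b (fun I => T I + T' I) I = D a b T I + D a b T' I.
Proof. by rewrite /D -big_split; apply: eq_bigr => k _; rewrite mulrDr. Qed.

(** By [invb_flip], changing the parity of one letter alters the Koszul sign by exactly the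
    difference of the signs of [D] before and after the permutation. *)
Lemma D_pact N (s : 'S_N) a b (T : N.-tuple letter -> R) I :
  D a b (pact s T) I = pact s (D a b T) I.
Proof.
rewrite pactE /D mulr_sumr (reindex_inj (@perm_inj _ s)) /=.
apply: eq_big => [k|k /eqP Ika]; first by rewrite tnth_subst.
rewrite pactE subst_replace !mulrA -!signr_addb; congr ((-1) ^+ nat_of_bool _ * _).
rewrite (@invb_flip _ _ (tpar I) _ (s k)) => [|i ne]; last first.
  by rewrite /tpar tnth_replace (negPf ne).
rewrite permK /tpar tnth_replace eqxx Ika -/(tpar I) (addbC (par b)) -/(parE a b).
have -> : beforeb (fun j => tpar I ((s^-1^-1)%g j)) k = beforeb (tpar (subst s I)) k.
  by apply: eq_bigr => j _; rewrite invgK /tpar tnth_subst.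
by case: parE; case: beforeb; case: invb; case: beforeb.
Qed.

(** Passes from coordinates to basis tensors: [D a b] turns one letter [b] of the basis sequence
    into [a]. *)
Lemma D_delta N a b (K I : N.-tuple letter) :
  D a b (delta R K) I =
  \sum_(k < N | tnth K k == b)
    (-1) ^+ (parE a b && beforeb (tpar K) k) * delta R (replace K k a) I.
Proof.
rewrite /D big_mkcond [RHS]big_mkcond /=; apply: eq_bigr => k _.
have := replace_swap I K k a b; rewrite /delta (eq_sym K).
case: (tnth I k == a); last first.
  by case: (tnth K k == b) => //= <-; rewrite mulr0.
case: (tnth K k == b) => /= ->; rewrite ?mulr0 //.
case: eqP => [->|_]; rewrite ?mulr0 // !mulr1.
by rewrite beforeb_replace ltnn addbF.
Qed.

(** Either both operators hit the same position, where the signs cancel, or they hit distinct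
    positions [k] and [l]; in that case the parity change at [k] adds a sign whenever [k < l]. *)
Lemma D_odd_comp N a b c d (T : N.-tuple letter -> R) I :
  parE c d -> parE b a ->
  D c d (D b a T) I =
  (d == b)%:R * (\sum_(k | tnth I k == c) T (replace I k a)) +
  \sum_(k | tnth I k == c) \sum_(l | (tnth I l == b) && (l != k))
    (-1) ^+ (beforeb (tpar I) k (+) beforeb (tpar I) l (+) (k < l)%N)
      * T (replace (replace I k d) l a).
Proof.
move=> pcd pba; rewrite mulr_sumr -big_split /=; apply: eq_bigr => k /eqP Ikc.
rewrite pcd /D pba /= (bigID (pred1 k)) /= mulrDr; congr (_ + _).
  rewrite (eq_bigl (fun l => (l == k) && (d == b))) => [|l]; last first.
    by rewrite tnth_replace andbC; case: (l == k).
  rewrite big_mkcondr big_pred1_eq; case: (d == b); last by rewrite mulr0 mul0r.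
  rewrite replace_replace beforeb_replace ltnn addbF mulrA mul1r.
  by rewrite -signr_addb addbb mul1r.
rewrite mulr_sumr; apply: eq_big => [l|l /andP[_ lk]].
  by rewrite tnth_replace; case: (l == k); rewrite ?andbF.
rewrite mulrA -signr_addb beforeb_replace /tpar Ikc addbC (addbC (par d)).
rewrite -/(parE c d) pcd andbT; congr ((-1) ^+ nat_of_bool _ * _).
by rewrite addbC addbA.
Qed.

(** The terms at distinct positions cancel, because exchanging the two positions turns [k < l] into
    [l < k]. The terms at equal positions give the superbracket. *)
Lemma D_anticomm N a b c d (T : N.-tuple letter -> R) I :
  ~~ par a -> ~~ par c -> par b -> par d ->
  D c d (D b a T) I + D b a (D c d T) I =
  (d == b)%:R * D c a T I + (a == c)%:R * D b d T I.
Proof.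
move=> pa pc pb pd.
have [pcd pba] : parE c d /\ parE b a.
  by rewrite /parE pb pd (negPf pa) (negPf pc).
rewrite !D_odd_comp //= addrACA [X in _ + X](_ : _ = 0) ?addr0.
  rewrite /D; congr (_ * _ + _ * _); apply: eq_bigr => k _.
    by rewrite /parE (negPf pa) (negPf pc) mul1r.
  by rewrite /parE pb pd mul1r.
rewrite [X in _ + X](exchange_big_dep (fun k => tnth I k == c)) /=; last first.
  by move=> l k _ /andP[].
rewrite -big_split big1 //= => k /eqP Ikc; apply/eqP; rewrite addr_eq0 -sumrN; apply/eqP.
apply: eq_big => [l|l /andP[_ lk]]; first by rewrite Ikc eqxx (eq_sym k).
rewrite replaceC 1?eq_sym // -mulNr -signrN (ltn_ordN lk).
by congr ((-1) ^+ nat_of_bool _ * _); rewrite addbN (addbC (beforeb _ k)).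
Qed.

End TensorOperators.

(** * Young operators: symmetries, equivariance and vanishing *)

Section YoungOperators.
Variables (R : fieldType) (n m : nat).
Hypothesis charR0 : [pchar R]%R =i pred0.
Local Open Scope ring_scope.
Notation letter := (idx n m).
Implicit Types (a b c d : letter).

Lemma eq_opp0 (x : R) : x = - x -> x = 0.
Proof.
move/eqP; rewrite -addr_eq0 -mulr2n -mulr_natl mulf_eq0.
by rewrite ((pcharf0P R).1 charR0 2) => /eqP.
Qed.

Lemma stabP N (pos : 'I_N -> nat) (s : 'S_N) :
  reflect (forall x, pos (s x) = pos x) (s \in stab pos).
Proof. by rewrite inE; apply: (iffP forallP) => H x; apply/eqP. Qed.

Lemma stab_mulr N (pos : 'I_N -> nat) (s t : 'S_N) :
  s \in stab pos -> ((t * s)%g \in stab pos) = (t \in stab pos).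
Proof.
move=> /stabP ss; apply/stabP/stabP => st x.
  by have := st x; rewrite permM ss.
by rewrite permM ss.
Qed.

Lemma stab_mull N (pos : 'I_N -> nat) (s t : 'S_N) :
  s \in stab pos -> ((s * t)%g \in stab pos) = (t \in stab pos).
Proof.
move=> /stabP ss; apply/stabP/stabP => st x.
  by have := st (s^-1%g x); rewrite permM permKV => ->; rewrite -{2}(permKV s x) ss.
by rewrite permM st.
Qed.

Lemma stab_tperm N (pos : 'I_N -> nat) i j : pos i = pos j -> tperm i j \in stab pos.
Proof. by move=> pij; apply/stabP => x; case: tpermP => // ->. Qed.

Lemma youngE_pact N (row col : 'I_N -> nat) (T : N.-tuple letter -> R) J :
  youngE row col T J = \sum_(tau in stab col) \sum_(sg in stab row)
             (-1) ^+ odd_perm tau * pact (tau * sg)%g T J.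
Proof. by apply: eq_bigr => t _; apply: eq_bigr => s _; rewrite pactM. Qed.

Lemma youngE'_pact N (row col : 'I_N -> nat) (T : N.-tuple letter -> R) J :
  youngE' row col T J = \sum_(tau in stab col) \sum_(sg in stab row)
             (-1) ^+ odd_perm tau * pact (sg * tau)%g T J.
Proof. by apply: eq_bigr => t _; apply: eq_bigr => s _; rewrite pactM. Qed.

(** Symmetry in the super sense: [pact] carries the Koszul sign, so odd letters within a row
    anticommute. *)
Definition row_symmetric N (row : 'I_N -> nat) (T : N.-tuple letter -> R) :=
  forall s, s \in stab row -> pact s T =1 T.

Definition col_alternating N (col : 'I_N -> nat) (T : N.-tuple letter -> R) :=
  forall s, s \in stab col -> forall J, pact s T J = (-1) ^+ odd_perm s * T J.

(** In [youngE] the row sum is applied last, so a further row permutation is absorbed by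
    translation. *)
Lemma youngE_row_symmetric N (row col : 'I_N -> nat) (T : N.-tuple letter -> R) :
  row_symmetric row (youngE row col T).
Proof.
move=> s ss J; rewrite (eq_pact s (youngE_pact row col T)) youngE_pact pact_sum.
apply: eq_bigr => t _; rewrite pact_sum [RHS](reindex_inj (mulIg s)) /=.
apply: eq_big => [g|g _]; first by rewrite stab_mulr.
by rewrite pactZ pactM mulgA.
Qed.

(** In [youngE'] the signed column sum is applied last. *)
Lemma youngE'_col_alternating N (row col : 'I_N -> nat) (T : N.-tuple letter -> R) :
  col_alternating col (youngE' row col T).
Proof.
move=> s ss J; rewrite (eq_pact s (youngE'_pact row col T)) youngE'_pact pact_sum.
rewrite mulr_sumr [RHS](reindex_inj (mulIg s)) /=.
apply: eq_big => [g|g _]; first by rewrite stab_mulr.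
rewrite pact_sum mulr_sumr; apply: eq_bigr => t _.
by rewrite pactZ pactM mulgA mulrA odd_permM signr_addb mulrCA -signr_addb addbb mulr1.
Qed.

Lemma D_youngE N (row col : 'I_N -> nat) a b (T : N.-tuple letter -> R) I :
  D a b (youngE row col T) I = youngE row col (D a b T) I.
Proof.
rewrite (eq_D a b (youngE_pact row col T)) youngE_pact D_sum.
apply: eq_bigr => t _; rewrite D_sum; apply: eq_bigr => s _.
by rewrite DZ D_pact.
Qed.

Lemma D_youngE' N (row col : 'I_N -> nat) a b (T : N.-tuple letter -> R) I :
  D a b (youngE' row col T) I = youngE' row col (D a b T) I.
Proof.
rewrite (eq_D a b (youngE'_pact row col T)) youngE'_pact D_sum.
apply: eq_bigr => t _; rewrite D_sum; apply: eq_bigr => s _.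
by rewrite DZ D_pact.
Qed.

Lemma youngE_lin N (row col : 'I_N -> nat) (K : finType) (P : pred K)
    (x : K -> R) (F : K -> N.-tuple letter -> R) (T : N.-tuple letter -> R) J :
  (forall I, T I = \sum_(k | P k) x k * F k I) ->
  youngE row col T J = \sum_(k | P k) x k * youngE row col (F k) J.
Proof.
move=> TE; rewrite youngE_pact.
under [RHS]eq_bigr do rewrite youngE_pact mulr_sumr.
rewrite [RHS]exchange_big; apply: eq_bigr => t _ /=.
under [RHS]eq_bigr do rewrite mulr_sumr.
rewrite [RHS]exchange_big; apply: eq_bigr => s _ /=.
rewrite (eq_pact _ TE) pact_sum mulr_sumr; apply: eq_bigr => k _.
by rewrite pactZ mulrCA.
Qed.

Lemma youngE'_lin N (row col : 'I_N -> nat) (K : finType) (P : pred K)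
    (x : K -> R) (F : K -> N.-tuple letter -> R) (T : N.-tuple letter -> R) J :
  (forall I, T I = \sum_(k | P k) x k * F k I) ->
  youngE' row col T J = \sum_(k | P k) x k * youngE' row col (F k) J.
Proof.
move=> TE; rewrite youngE'_pact.
under [RHS]eq_bigr do rewrite youngE'_pact mulr_sumr.
rewrite [RHS]exchange_big; apply: eq_bigr => t _ /=.
under [RHS]eq_bigr do rewrite mulr_sumr.
rewrite [RHS]exchange_big; apply: eq_bigr => s _ /=.
rewrite (eq_pact _ TE) pact_sum mulr_sumr; apply: eq_bigr => k _.
by rewrite pactZ mulrCA.
Qed.

Lemma D_youngE_delta N (row col : 'I_N -> nat) a b (K I : N.-tuple letter) :
  D a b (youngE row col (delta R K)) I =
  \sum_(k < N | tnth K k == b) (-1) ^+ (parE a b && beforeb (tpar K) k)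
    * youngE row col (delta R (replace K k a)) I.
Proof. by rewrite D_youngE; apply: youngE_lin => J; rewrite D_delta. Qed.

Lemma D_youngE'_delta N (row col : 'I_N -> nat) a b (K I : N.-tuple letter) :
  D a b (youngE' row col (delta R K)) I =
  \sum_(k < N | tnth K k == b) (-1) ^+ (parE a b && beforeb (tpar K) k)
    * youngE' row col (delta R (replace K k a)) I.
Proof. by rewrite D_youngE'; apply: youngE'_lin => J; rewrite D_delta. Qed.

Lemma subst_tperm N (I : N.-tuple letter) i j :
  tnth I i = tnth I j -> subst (tperm i j) I = I.
Proof.
move=> Iij; apply: eq_from_tnth => x; rewrite tnth_subst.
by case: tpermP => // ->.
Qed.

Lemma pact_tperm N (T : N.-tuple letter -> R) (J : N.-tuple letter) i j :
  i != j -> tnth J i = tnth J j ->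
  pact (tperm i j) T J = (-1) ^+ par (tnth J i) * T J.
Proof.
by move=> ij Jij; rewrite pactE tpermV invb_tperm ?subst_tperm // /tpar Jij.
Qed.

Lemma pact_tperm_delta N (K J : N.-tuple letter) i j :
  i != j -> tnth K i = tnth K j ->
  pact (tperm i j) (delta R K) J = (-1) ^+ par (tnth K i) * delta R K J.
Proof.
move=> ij Kij; have [->|neJ] := eqVneq J K; first exact: pact_tperm.
rewrite pactE /delta (negPf neJ); case: eqP => [eJ|_]; last by rewrite !mulr0.
case/eqP: neJ; rewrite -(substK (tperm i j) J) tpermV eJ.
exact: subst_tperm.
Qed.

(** Swapping the two equal even letters fixes the basis tensor, while the column sum, which is
    applied first, changes sign; the value is its own negative. *)
Lemma youngE_delta_eq0 N (row col : 'I_N -> nat) (K J : N.-tuple letter) i j :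
  i != j -> col i = col j -> tnth K i = tnth K j -> ~~ par (tnth K i) ->
  youngE row col (delta R K) J = 0.
Proof.
move=> ij cij Kij pK; apply: eq_opp0; rewrite youngE_pact.
rewrite {1}(reindex_inj (mulgI (tperm i j))) -sumrN /=.
apply: eq_big => [t|t _]; first by rewrite stab_mull // stab_tperm.
rewrite -sumrN; apply: eq_bigr => s _.
rewrite odd_permM odd_tperm ij /= signrN mulNr -mulgA -pactM.
rewrite (eq_pact _ (fun J => pact_tperm_delta J ij Kij)).
by rewrite (negPf pK) pactZ mul1r.
Qed.

(** Here the row sum is applied first, and swapping two equal odd letters costs the Koszul sign
    [-1]. *)
Lemma youngE'_delta_eq0 N (row col : 'I_N -> nat) (K J : N.-tuple letter) i j :
  i != j -> row i = row j -> tnth K i = tnth K j -> par (tnth K i) ->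
  youngE' row col (delta R K) J = 0.
Proof.
move=> ij cij Kij pK; apply: eq_opp0; rewrite youngE'_pact -sumrN.
apply: eq_bigr => t _.
rewrite [LHS](reindex_inj (mulgI (tperm i j))) -sumrN /=.
apply: eq_big => [s|s _]; first by rewrite stab_mull // stab_tperm.
rewrite -mulgA -pactM (eq_pact _ (fun J => pact_tperm_delta J ij Kij)).
by rewrite pK pactZ mulN1r mulrN.
Qed.

(** The counterpart on the output side: it concerns the coordinates of an alternating tensor instead
    of the basis tensor fed to a Young operator. *)
Lemma col_alternating_eq0 N (col : 'I_N -> nat) (T : N.-tuple letter -> R) J i j :
  col_alternating col T -> i != j -> col i = col j -> tnth J i = tnth J j ->
  ~~ par (tnth J i) -> T J = 0.
Proof.
move=> Tc ij cij Jij pJ; apply: eq_opp0.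
have := Tc _ (stab_tperm cij) J.
by rewrite odd_tperm ij mulN1r pact_tperm // (negPf pJ) mul1r.
Qed.

Lemma pact_delta_supp N (s : 'S_N) (K J : N.-tuple letter) :
  count (@par n m) J != count (@par n m) K -> pact s (delta R K) J = 0.
Proof.
move=> neq; rewrite pactE /delta; case: eqP => [e|_]; last by rewrite mulr0.
by case/eqP: neq; rewrite -e count_subst.
Qed.

Lemma youngE_delta_supp N (row col : 'I_N -> nat) (K J : N.-tuple letter) :
  count (@par n m) J != count (@par n m) K -> youngE row col (delta R K) J = 0.
Proof.
move=> neq; rewrite youngE_pact big1 // => t _; rewrite big1 // => s _.
by rewrite pact_delta_supp ?mulr0.
Qed.

Lemma youngE'_delta_supp N (row col : 'I_N -> nat) (K J : N.-tuple letter) :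
  count (@par n m) J != count (@par n m) K -> youngE' row col (delta R K) J = 0.
Proof.
move=> neq; rewrite youngE'_pact big1 // => t _; rewrite big1 // => s _.
by rewrite pact_delta_supp ?mulr0.
Qed.

End YoungOperators.

(** * The generic square matrix over a polynomial ring *)

Section GenericMatrix.
Variables (R : fieldType) (n : nat).
Local Open Scope ring_scope.

Definition cell (i c : 'I_n) : 'I_#|{: 'I_n * 'I_n}| := enum_rank (i, c).

Lemma cell_inj i c i' c' : (cell i c == cell i' c') = (i == i') && (c == c').
Proof. by rewrite (inj_eq enum_rank_inj). Qed.

Definition generic_mx : 'M[{mpoly R[#|{: 'I_n * 'I_n}|]}]_n :=
  \matrix_(i, c) 'X_(cell i c).

(** Specialising the variable of the cell [(i, c)] to 1 if [i = c] and to 0 otherwise gives the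
    identity matrix. *)
Lemma det_generic_mx_neq0 : \det generic_mx != 0.
Proof.
apply/eqP => /(congr1 (meval (fun p => ((enum_val p).1 == (enum_val p).2)%:R))).
rewrite -det_map_mx meval0 (_ : map_mx _ _ = 1%:M) ?det1; last first.
  by apply/matrixP => i j; rewrite !mxE /= mevalXU enum_rankK.
by move/eqP; rewrite oner_eq0.
Qed.

(** Multiplying by the adjugate gives [\det generic_mx] times [H i], and polynomials over a field
    form a domain. *)
Lemma generic_mx_inj (H : 'I_n -> {mpoly R[#|{: 'I_n * 'I_n}|]}) :
  (forall c, \sum_i 'X_(cell i c) * H i = 0) -> forall i, H i = 0.
Proof.
move=> H0 i; pose v := \row_i H i.
have v0 : v *m generic_mx = 0.
  apply/rowP => c; rewrite !mxE -[RHS](H0 c); apply: eq_bigr => j _.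
  by rewrite !mxE mulrC.
have : (v *m (generic_mx *m \adj generic_mx)) 0 i = 0.
  by rewrite mulmxA v0 mul0mx mxE.
rewrite mul_mx_adj mul_mx_scalar !mxE => /eqP.
by rewrite mulf_eq0 (negPf det_generic_mx_neq0) => /eqP.
Qed.

End GenericMatrix.

(** * Row-symmetric tensors as superpolynomials *)

Section RowSymmetric.
Variables (R : fieldType) (n m : nat).
Hypothesis charR0 : [pchar R]%R =i pred0.
Local Open Scope ring_scope.
Notation letter := (idx n m).
Notation mon := 'X_{1.. #|{: 'I_n * 'I_n}|}.
Notation pol := {mpoly R[#|{: 'I_n * 'I_n}|]}.
Variables (N : nat) (rw : 'I_N -> 'I_n).
Notation row := (fun x => nat_of_ord (rw x)).
Implicit Types (I J K : N.-tuple letter).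

Definition letter_mon (i : 'I_n) (x : letter) : mon :=
  if x is inl c then U_(cell i c)%MM else 0%MM.

(** The exponents of the commuting variables only: an odd letter contributes nothing, since its
    position is tracked separately. *)
Definition content K : mon := (\sum_(l < N) letter_mon (rw l) (tnth K l))%MM.

Lemma content_subst (s : 'S_N) K : s \in stab row -> content (subst s K) = content K.
Proof.
move=> /stabP ss; rewrite /content [RHS](reindex_inj (@perm_inj _ s)).
apply: eq_bigr => l _; rewrite tnth_subst; congr (letter_mon _ _).
exact/esym/val_inj/ss.
Qed.

Lemma content_replace K k c : par (tnth K k) ->
  content (replace K k (inl c)) = (U_(cell (rw k) c) + content K)%MM.
Proof.
move=> pK; rewrite /content (bigD1 k) //= [in RHS](bigD1 k) //=.
rewrite tnth_replace eqxx /= [letter_mon _ (tnth K k)](_ : _ = 0%MM); last first.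
  by case: (tnth K k) pK.
rewrite add0m; congr (_ + _)%MM; apply: eq_bigr => l /negPf lk.
by rewrite tnth_replace lk.
Qed.

Lemma content_count K i c :
  content K (cell i c) = #|[set l | (rw l == i) && (tnth K l == inl c)]|.
Proof.
rewrite /content mnm_sumE -sum1_card big_mkcond [RHS]big_mkcond /=.
apply: eq_bigr => l _; rewrite inE; case: (tnth K l) => [c'|d] /=.
  rewrite mnm1E cell_inj (inj_eq inl_inj).
  by case: (_ && _).
by rewrite mnm0E andbF.
Qed.

(** The two sequences differ by a row permutation that moves even letters only, and such a
    permutation has trivial Koszul sign. *)
Lemma row_symmetric_content (T : N.-tuple letter -> R) K I :
  row_symmetric row T -> content K = content I ->
  (forall l, par (tnth K l) || par (tnth I l) -> tnth K l = tnth I l) ->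
  T K = T I.
Proof.
move=> Ts eKI odd_eq.
have par_eq l : par (tnth K l) = par (tnth I l).
  by apply/idP/idP => p; [rewrite -odd_eq ?p|rewrite odd_eq ?p ?orbT].
(* An odd letter records its own position, so a permutation matching the marks must fix it. *)
pose mark J l := (rw l, tnth J l, if par (tnth J l) then Some l else None).
pose marks J := [tuple mark J l | l < N].
have : perm_eq (marks K) (marks I).
  apply/allP => -[[i x] o] _; apply/eqP.
  have cE J : count_mem (i, x, o) (marks J) = #|[set l | mark J l == (i, x, o)]|.
    rewrite -sum1_count big_tuple -sum1_card; apply: eq_bigl => l.
    by rewrite inE tnth_mktuple.
  rewrite !cE {cE}; case: x => [c|d].
    case: o => [l|].
      have c0 J : [set l' | mark J l' == (i, inl c, Some l)] = set0.
        apply/setP => l'; rewrite !inE /mark !xpair_eqE.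
        by case: (tnth J l') => x; rewrite ?andbF.
      by rewrite !c0.
    have c1 J : #|[set l | mark J l == (i, inl c, None)]| = content J (cell i c).
      rewrite content_count; apply: eq_card => l.
      by rewrite !inE /mark !xpair_eqE; case: (tnth J l) => x; rewrite ?andbT ?andbF.
    by rewrite !c1 eKI.
  apply: eq_card => l; rewrite !inE /mark !xpair_eqE par_eq.
  case p: (par (tnth I l)); first by rewrite odd_eq // p orbT.
  by move: p (par_eq l); case: (tnth K l) => ?; case: (tnth I l) => ?.
case/tuple_permP => p eqp.
have {}eqp l : mark K l = mark I (p l).
  rewrite -[LHS](tnth_mktuple (mark K)) -[in RHS](tnth_mktuple (mark I)).
  by rewrite -(tnth_mktuple (fun j => tnth (marks I) (p j))); congr tnth; apply: val_inj.
have ps : p \in stab row by apply/stabP => l; case: (eqp l) => ->.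
have Kp : K = subst p I.
  by apply: eq_from_tnth => l; rewrite tnth_subst; case: (eqp l).
have pfix l : par (tnth I l) -> p l = l.
  move=> pl; case: (eqp l) => _ eKp; rewrite -eKp par_eq pl.
  by case.
rewrite -(Ts _ ps I) pactE -Kp invb_fix ?mul1r // => l pl.
by rewrite -[in LHS](pfix l pl) permK.
Qed.

(* Read as polynomials in commuting [x_ic] and anticommuting [xi_id] (row [i],
   letter [c] or [d]), row-symmetric tensors satisfy
   [sum_i x_ic * dT/dxi_id = 0] for every [c]; since the [n x n] matrix [x] is
   generic, every [dT/dxi_id] vanishes. *)
Lemma row_symmetric_killed_eq0 (T : N.-tuple letter -> R) k I0 :
  row_symmetric row T ->
  (forall c d I, (count (@par n m) I).+1 = k -> D (inl c) (inr d) T I = 0) ->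
  (0 < k)%N -> count (@par n m) I0 = k -> T I0 = 0.
Proof.
move=> Ts Tk k_gt0 I0k.
have [k0 [d I0d]] : exists k0 d, tnth I0 k0 = inr d.
  have /hasP[x /tnthP[k0 ->]] : has (@par n m) I0 by rewrite has_count I0k.
  by case E: (tnth I0 k0) => [//|d] _; exists k0, d.
(* Freeze the odd letters of [I0] outside [k0]. In [pat k], the letter [inr d] sits at [k] and all
   remaining positions are even; [G k] is the generating polynomial of [T] over these sequences. *)
pose odd0 l := (l != k0) && par (tnth I0 l).
pose fits K l := if odd0 l then tnth K l == tnth I0 l else ~~ par (tnth K l).
pose pat0 J := [forall l, fits J l].
pose pat k K := [forall l, if l == k then tnth K l == inr d else fits K l].
pose G k : pol := \sum_(K | pat k K) T K *: 'X_[content K].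
have pat0_par J : pat0 J -> tpar J =1 odd0.
  move=> /forallP pJ l; rewrite /tpar; have := pJ l; rewrite /fits.
  by case: (boolP (odd0 l)) => [/andP[_ pl] /eqP->|_ /negPf].
have pat_par k' K : ~~ odd0 k' -> pat k' K ->
    (fun l => (l != k') && par (tnth K l)) =1 odd0.
  move=> Sk /forallP pJ l; have := pJ l; rewrite /fits.
  have [->|_] /= := eqVneq l k'; first by rewrite (negPf Sk).
  by case: (boolP (odd0 l)) => [/andP[_ pl] /eqP->|_ /negPf].
have pat0_count J : pat0 J -> (count (@par n m) J).+1 = k.
  move=> pJ; rewrite -I0k !count_par_sum [in RHS](bigD1 k0) //= {2}/tpar I0d /= add1n; congr _.+1.
  rewrite (eq_bigr (fun l => odd0 l : nat)) => [|l _]; last by rewrite pat0_par.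
  rewrite [RHS]big_mkcond; apply: eq_bigr => l _; rewrite /odd0 /tpar.
  by case: (l != k0).
(* The vanishing hypotheses at all sequences [J] in [pat0], weighted by the monomial of [J], add up
   to one linear relation with generic coefficients. *)
have H0 c : \sum_i 'X_(cell i c) *
    (\sum_(k | ~~ odd0 k && (rw k == i)) (-1) ^+ beforeb odd0 k *: G k) = 0.
  transitivity (\sum_(J | pat0 J) D (inl c) (inr d) T J *: 'X_[R, content J]);
    last by rewrite big1 // => J pJ; rewrite Tk ?scale0r // pat0_count.
  transitivity (\sum_(k | ~~ odd0 k) (-1) ^+ beforeb odd0 k *: ('X_(cell (rw k) c) * G k)).
    rewrite (partition_big rw xpredT) //=; apply: eq_bigr => i _.
    rewrite mulr_sumr; apply: eq_bigr => j /andP[_ /eqP ->].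
    by rewrite -scalerAr.
  rewrite /D; under [RHS]eq_bigr do rewrite scaler_suml.
  rewrite (exchange_big_dep (fun k => ~~ odd0 k)) /= => [|J j pJ /eqP Jj]; last first.
    by rewrite -(pat0_par _ pJ) /tpar Jj.
  apply: eq_bigr => j Sj.
  (* Putting [inr d] back at [j] splits the variable of row [rw j] and letter [c] off the
     monomial. *)
  rewrite (reindex_onto (fun K => replace K j (inl c)) (fun J => replace J j (inr d))) /=;
    last by move=> J /andP[_ /eqP <-]; rewrite replace_replace replace_id.
  rewrite /G mulr_sumr scaler_sumr; apply: eq_big => [K|K pK].
    rewrite tnth_replace !eqxx andbT replace_replace.
    apply/forallP/andP => [pK|[/forallP pK /eqP eK] l].
      split; last first.
        by have := pK j; rewrite eqxx => /eqP <-; rewrite replace_id.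
      apply/forallP => l; have := pK l; rewrite /fits tnth_replace.
      by have [->|//] := eqVneq l j; rewrite (negPf Sj).
    have [->|ne] := eqVneq l j; first by rewrite -eK tnth_replace eqxx.
    by have := pK l; rewrite /fits tnth_replace (negPf ne).
  have Kj : tnth K j = inr d by move/forallP/(_ j): pK; rewrite eqxx => /eqP.
  have Kr : replace K j (inr d) = K by rewrite -Kj replace_id.
  rewrite replace_replace Kr content_replace ?Kj //.
  rewrite mpolyXD -scalerAr scalerA; congr ((-1) ^+ nat_of_bool _ * _ *: _).
  rewrite /=; apply: eq_bigr => l _; congr (_ && _).
  have := pat_par _ _ Sj pK l => <-; rewrite /tpar tnth_replace.
  by case: (l == j).
have {}H0 := generic_mx_inj H0 (rw k0).
have Sk0 : ~~ odd0 k0 by rewrite /odd0 eqxx.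
(* Positions in one row contribute equally: the transposition of [k0] and [j] is a row permutation,
   and [invb_tperm_move] computes its sign. Hence the row sum is a positive multiple of [G k0] up to
   sign. *)
have Gsym j : ~~ odd0 j && (rw j == rw k0) ->
    (-1) ^+ beforeb odd0 j *: G j = (-1) ^+ beforeb odd0 k0 *: G k0.
  case/andP=> Sj /eqP rj; have [->//|ne] := eqVneq k0 j.
  have tS : tperm k0 j \in stab row by apply: stab_tperm; rewrite rj.
  have patE K : pat j (subst (tperm k0 j) K) = pat k0 K.
    have nj : j != k0 by rewrite eq_sym.
    apply/forallP/forallP => pK l.
      have [->|lk] := eqVneq l k0.
        by have := pK j; rewrite eqxx tnth_subst tpermR.
      have [->|lj] := eqVneq l j.
        have := pK k0; rewrite (negPf ne) /fits tnth_subst tpermL.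
        by rewrite (negPf Sk0) (negPf Sj).
      by have := pK l; rewrite (negPf lj) /fits tnth_subst tpermD // eq_sym.
    have [->|lj] := eqVneq l j.
      by have := pK k0; rewrite eqxx tnth_subst tpermR.
    have [->|lk] := eqVneq l k0.
      have := pK j; rewrite (negPf nj) /fits tnth_subst tpermL.
      by rewrite (negPf Sk0) (negPf Sj).
    by have := pK l; rewrite (negPf lk) /fits tnth_subst tpermD // eq_sym.
  rewrite /G (reindex_inj (can_inj (substK (tperm k0 j)))) !scaler_sumr.
  apply: eq_big => [K|K]; rewrite patE // => pK.
  have pk0 : par (tnth K k0) by move/forallP/(_ k0): pK; rewrite eqxx => /eqP ->.
  have pj : ~~ par (tnth K j).
    move/forallP/(_ j): pK; rewrite eq_sym (negPf ne) /fits.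
    by rewrite (negPf Sj).
  rewrite content_subst // -(Ts _ tS K) pactE tpermV invb_tperm_move //.
  have eqb l : beforeb (fun x => (x != k0) && tpar K x) l = beforeb odd0 l.
    by apply: eq_bigr => x _; rewrite -(pat_par _ _ Sk0 pK).
  rewrite !eqb signr_addb !scalerA !mulrA -signr_addb addbb mul1r //.
move: H0; rewrite (eq_bigr _ Gsym) sumr_const -scaler_nat.
move/eqP; rewrite !scaler_eq0 signr_eq0 /= ((pcharf0P R).1 charR0).
have /negPf-> /= : #|[pred k1 | ~~ odd0 k1 & rw k1 == rw k0]| != 0%N.
  by rewrite -lt0n; apply/card_gt0P; exists k0; rewrite inE Sk0 eqxx.
(* By [row_symmetric_content], this coefficient is [T I0] times the number of sequences with the
   content of [I0]; that number is positive, as [I0] is one of them. *)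
move=> /eqP /(congr1 (mcoeff (content I0))); rewrite mcoeff0 /G raddf_sum /=.
have pI0 : pat k0 I0.
  apply/forallP => l; have [->|lk] := eqVneq l k0; first by rewrite I0d.
  by rewrite /fits /odd0 lk; case: (boolP (par _)) => /=.
rewrite (eq_bigr (fun K => if content K == content I0 then T I0 else 0)) => [|K pK]; last first.
  rewrite mcoeffZ mcoeffX; case: eqP => [eK|_]; last by rewrite mulr0.
  rewrite mulr1; apply: (row_symmetric_content Ts eK) => l.
  have [->|lk] := eqVneq l k0.
    by move/forallP/(_ k0): pK; rewrite eqxx I0d => /eqP.
  move/forallP/(_ l): pK; rewrite (negPf lk) /fits /odd0 lk.
  by case: (boolP (par (tnth I0 l))) => /= _ => [/eqP|/negPf->].
rewrite -big_mkcondr sumr_const => /eqP; rewrite -mulr_natl mulf_eq0.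
rewrite ((pcharf0P R).1 charR0) => /orP[/eqP c0|/eqP//].
have : (0 < #|[pred K | pat k0 K & content K == content I0]|)%N.
  by apply/card_gt0P; exists I0; rewrite inE pI0 eqxx.
by rewrite c0.
Qed.

End RowSymmetric.

(** * The action of gl(V) on mixed tensors *)

Section GlAction.
Variables (R : fieldType) (n m : nat).
Local Open Scope ring_scope.
Notation letter := (idx n m).
Implicit Types (a b c d : letter).

Definition oddI N (I : N.-tuple letter) : bool := odd (count (@par n m) I).

Lemma count_replace N (I : N.-tuple letter) k x :
  (count (@par n m) (replace I k x) + par (tnth I k) = count (@par n m) I + par x)%N.
Proof.
rewrite !count_par_sum (bigD1 k) //= [in RHS](bigD1 k) //= {1}/tpar tnth_replace eqxx.
rewrite (eq_bigr (fun l => tpar I l : nat)) => [|l /negPf lk]; last first.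
  by rewrite /tpar tnth_replace lk.
by rewrite addnAC [RHS]addnAC (addnC (par x)).
Qed.

Lemma oddI_replace N (I : N.-tuple letter) k x :
  oddI (replace I k x) = oddI I (+) parE (tnth I k) x.
Proof.
have /(congr1 odd) := count_replace I k x; rewrite !oddD !oddb => H.
by rewrite /oddI /parE (addbC (par _)) addbA -H addbK.
Qed.

(** The dual action on the [V^*]-factors, plus the action on the [V]-factors with the sign for
    passing [E_ab] across the [V^*]-factors. *)
Definition Etot A B a b (w : A.-tuple letter -> B.-tuple letter -> R) I J : R :=
  - (-1) ^+ (parE a b && par a) * D b a (fun I => w I J) I +
  (-1) ^+ (parE a b && oddI I) * D a b (w I) J.

(** Once the position of the moved letter is fixed, the target determines the source
    ([replace_swap]), so the sums over [I] and [J] collapse. *)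
Lemma glactE A B X (w : A.-tuple letter -> B.-tuple letter -> R) I' J' :
  glact X w I' J' = \sum_a \sum_b X a b * Etot a b w I' J'.
Proof.
apply: eq_bigr => a _; apply: eq_bigr => b _; congr (_ * _).
rewrite /Eact /Etot -/(parE a b).
have sgE (e : bool) (k : nat) : (-1) ^+ (e * k)%N = (-1) ^+ (e && odd k) :> R.
  by rewrite -signr_odd oddM; case: e.
transitivity (\sum_I \sum_J (\sum_(k < A) (w I J *
     (if tnth I k == a then
        (-1) ^+ (parE a b * par_before I k)%N * (- (-1) ^+ (parE a b * par a)%N) *
        (if (I' == replace I k b) && (J' == J) then 1 else 0)
      else 0))) +
   \sum_I \sum_J (\sum_(k < B) (w I J * 
     (if tnth J k == b then
        (-1) ^+ (parE a b * (count (@par n m) I + par_before J k))%N *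
        (if (I' == I) && (J' == replace J k a) then 1 else 0)
      else 0)))).
  rewrite -big_split; apply: eq_bigr => I _; rewrite -big_split.
  by apply: eq_bigr => J _; rewrite mulrDr !mulr_sumr.
congr (_ + _).
  rewrite /D mulr_sumr [RHS]big_mkcond exchange_big /= (bigD1 J') //=.
  rewrite [X in _ + X]big1 ?addr0 => [|J neJ]; last first.
    rewrite big1 // => I _; rewrite big1 // => k _.
    by rewrite (eq_sym J') (negPf neJ) andbF !mulr0 if_same mulr0.
  rewrite exchange_big; apply: eq_bigr => k _ /=.
  rewrite (bigD1 (replace I' k a)) //= tnth_replace eqxx.
  rewrite eqxx replace_replace [X in _ + X]big1 ?addr0 => [|I neI]; last first.
    rewrite eqxx andbT; have := replace_swap I I' k a b; rewrite (negPf neI) andbF.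
    by case: (tnth I k == a) => /= [->|_]; rewrite !mulr0.
  case: (eqVneq (tnth I' k) b) => [<-|ne]; last first.
    rewrite (_ : I' == _ = false) ?mulr0 //; apply: contraNF ne => /eqP ->.
    by rewrite tnth_replace eqxx.
  rewrite replace_id !eqxx mulr1 !sgE odd_par_before beforeb_replace ltnn addbF.
  rewrite oddb /parE (addbC (par a)) mulrA mulrC mulrN mulNr.
  by congr (- _ * _); apply: mulrC.
rewrite /D mulr_sumr [RHS]big_mkcond (bigD1 I') //=.
rewrite [X in _ + X]big1 ?addr0 => [|I neI]; last first.
  rewrite big1 // => J _; rewrite big1 // => k _.
  by rewrite (eq_sym I') (negPf neI) !mulr0 if_same mulr0.
rewrite exchange_big; apply: eq_bigr => k _ /=.
rewrite (bigD1 (replace J' k b)) //= tnth_replace !eqxx.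
rewrite replace_replace [X in _ + X]big1 ?addr0 => [|J neJ]; last first.
  have := replace_swap J J' k b a; rewrite (negPf neJ) andbF.
  by case: (tnth J k == b) => /= [->|_]; rewrite !mulr0.
case: (eqVneq (tnth J' k) a) => [<-|ne]; last first.
  rewrite (_ : J' == _ = false) ?mulr0 //; apply: contraNF ne => /eqP ->.
  by rewrite tnth_replace eqxx.
rewrite replace_id !eqxx mulr1 sgE oddD odd_par_before beforeb_replace ltnn addbF.
rewrite mulrC mulrA -signr_addb; congr ((-1) ^+ nat_of_bool _ * _).
by case: parE.
Qed.

(** An odd operator changes the total parity, so it anticommutes with the parity sign. *)
Lemma D_twist N c d (F : N.-tuple letter -> R) I : parE c d ->
  D c d (fun I => (-1) ^+ oddI I * F I) I = - (-1) ^+ oddI I * D c d F I.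
Proof.
move=> pcd; rewrite /D mulr_sumr; apply: eq_bigr => k /eqP Ik.
by rewrite oddI_replace Ik pcd addbT signrN mulrCA.
Qed.

Lemma D_DC A B a b c d (w : A.-tuple letter -> B.-tuple letter -> R) I J :
  D c d (fun I => D a b (w I) J) I = D a b (fun J => D c d (fun I => w I J) I) J.
Proof.
rewrite /D; under eq_bigr do rewrite mulr_sumr.
rewrite exchange_big; apply: eq_bigr => k _; rewrite mulr_sumr.
by apply: eq_bigr => l _; rewrite mulrCA.
Qed.

(** [D] commutes with [pact], and the parity sign depends only on the number of odd letters, which
    permutations preserve. *)
Lemma row_symmetric_Etot A B (row : 'I_A -> nat) a b
    (w : A.-tuple letter -> B.-tuple letter -> R) :
  (forall J, row_symmetric row (fun I => w I J)) ->
  forall J, row_symmetric row (fun I => Etot a b w I J).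
Proof.
move=> wr J s ss I; rewrite pactE /Etot mulrDr mulrCA -pactE -D_pact.
rewrite (eq_D _ _ (wr J s ss)); congr (_ + _).
rewrite /oddI count_subst mulrCA; congr (_ * _); rewrite -DZ; apply: eq_D => J' /=.
by rewrite -[RHS](wr J' s ss) pactE.
Qed.

Lemma col_alternating_Etot A B (col : 'I_B -> nat) a b
    (w : A.-tuple letter -> B.-tuple letter -> R) :
  (forall I, col_alternating col (w I)) ->
  forall I, col_alternating col (Etot a b w I).
Proof.
move=> wc I s ss J; rewrite pactE /Etot mulrDr [RHS]mulrDr; congr (_ + _).
  rewrite mulrCA [RHS]mulrCA; congr (_ * _); rewrite -!DZ; apply: eq_D => I' /=.
  by rewrite -(wc I' s ss J) pactE.
rewrite mulrCA -pactE -D_pact (eq_D _ _ (wc I s ss)) DZ.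
exact: mulrCA.
Qed.

(* The super Jacobi identity [E_dc E_ab w = [E_dc, E_ab] w - E_ab E_dc w]. *)
Lemma Etot_lower_raise A B a b c d
    (w : A.-tuple letter -> B.-tuple letter -> R) I J :
  ~~ par a -> ~~ par c -> par b -> par d ->
  (forall I J, Etot d c w I J = 0) ->
  Etot d c (Etot a b w) I J =
  (d == b)%:R * Etot a c w I J + (a == c)%:R * Etot d b w I J.
Proof.
move=> pa pc pb pd w0.
have pE (x y : letter) : ~~ par x -> par y ->
    (parE x y) * (parE y x) * (par x = false) * (par y = true).
  by rewrite /parE => /negPf-> ->.
have pEcd := pE c d pc pd; have pEab := pE a b pa pb.
have pEE (x y : letter) : par x = par y -> parE x y = false.
  by rewrite /parE => ->; rewrite addbb.
(* The hypothesis [w0] trades the action of [E_dc] on one group of factors for its action on the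
   other. The mixed terms thereby become compositions on a single group, leaving two anticommutators
   for [D_anticomm]. *)
have w1 I1 J1 : D c d (fun I => w I J1) I1 = - (-1) ^+ oddI I1 * D d c (w I1) J1.
  have /eqP := w0 I1 J1; rewrite /Etot !pEcd /= expr1 opprK mul1r.
  by rewrite addr_eq0 => /eqP ->; rewrite mulNr.
have w2 I1 J1 : D d c (w I1) J1 = - (-1) ^+ oddI I1 * D c d (fun I => w I J1) I1.
  by rewrite w1 mulrA mulrNN -signr_addb addbb mul1r.
rewrite {1}/Etot !pEcd /= expr1 opprK mul1r.
have -> : D c d (fun I => Etot a b w I J) I =
    - D c d (D b a (fun I => w I J)) I + D a b (D d c (w I)) J.
  rewrite /Etot !pEab /= DD (DZ _ _ (-1)) mulN1r; congr (_ + _).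
  rewrite D_twist ?pEcd // D_DC (eq_D _ _ (w1 I)) DZ mulrA mulrNN.
  by rewrite -signr_addb addbb mul1r.
have -> : D d c (Etot a b w I) J =
    - (-1) ^+ oddI I * D b a (D c d (fun I => w I J)) I
    + (-1) ^+ oddI I * D d c (D a b (w I)) J.
  rewrite /Etot !pEab /= DD !DZ mulN1r; congr (_ + _).
  rewrite -D_DC (eq_D _ _ (fun I1 => w2 I1 J)).
  rewrite (eq_D _ _ (T' := fun I1 => -1 * ((-1) ^+ oddI I1 * D c d (fun I => w I J) I1))).
    by rewrite DZ D_twist ?pEab // mulN1r opprK.
  by move=> I1; rewrite mulN1r mulNr.
rewrite mulrDr !mulrA mulrN -signr_addb addbb mul1r mulN1r addrACA -opprD.
rewrite !D_anticomm // /Etot !(pEE a c) ?(negPf pa) ?(negPf pc) // !(pEE d b) ?pb ?pd //=.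
rewrite (eq_sym b) (eq_sym c) !mulN1r !mul1r !mulrDr !mulrN opprD.
by rewrite addrACA.
Qed.

End GlAction.

(** * Concatenated sequences and the sign of the canonical invariant *)

Section Concatenation.
Variables (n m : nat).
Notation letter := (idx n m).

Lemma oddI_xor N (L : N.-tuple letter) :
  oddI L = \big[addb/false]_(l : 'I_N) tpar L l.
Proof.
rewrite /oddI -sum1_count big_tuple odd_sum big_mkcond /=.
by apply: eq_bigr => l _; rewrite /tpar; case: par.
Qed.

Lemma tnth_cat_l N N' (A : N.-tuple letter) (B : N'.-tuple letter) k :
  tnth (cat_tuple A B) (lshift N' k) = tnth A k.
Proof. exact: tnth_lshift. Qed.

Lemma tnth_cat_r N N' (A : N.-tuple letter) (B : N'.-tuple letter) k :
  tnth (cat_tuple A B) (rshift N k) = tnth B k.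
Proof. exact: tnth_rshift. Qed.

Lemma replace_cat_l N N' (A : N.-tuple letter) (B : N'.-tuple letter) k x :
  replace (cat_tuple A B) (lshift N' k) x = cat_tuple (replace A k x) B.
Proof.
apply: eq_from_tnth => j; rewrite tnth_replace.
case: (split_ordP j) => i ->; rewrite ?eq_lshift ?eq_rlshift ?tnth_cat_l ?tnth_cat_r //.
by rewrite tnth_replace.
Qed.

Lemma replace_cat_r N N' (A : N.-tuple letter) (B : N'.-tuple letter) k x :
  replace (cat_tuple A B) (rshift N k) x = cat_tuple A (replace B k x).
Proof.
apply: eq_from_tnth => j; rewrite tnth_replace.
case: (split_ordP j) => i ->; rewrite ?eq_rshift ?eq_lrshift ?tnth_cat_l ?tnth_cat_r //.
by rewrite tnth_replace.
Qed.

Lemma beforeb_cat_l N N' (A : N.-tuple letter) (B : N'.-tuple letter) k :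
  beforeb (tpar (cat_tuple A B)) (lshift N' k) = beforeb (tpar A) k.
Proof.
rewrite /beforeb big_split_ord /= [X in _ (+) X]big1 ?addbF => [|l _].
  by apply: eq_bigr => l _; rewrite /tpar tnth_cat_l.
by rewrite ltnNge ltnW // (leq_trans (ltn_ord k)) ?leq_addr.
Qed.

Lemma beforeb_cat_r N N' (A : N.-tuple letter) (B : N'.-tuple letter) k :
  beforeb (tpar (cat_tuple A B)) (rshift N k) = oddI A (+) beforeb (tpar B) k.
Proof.
rewrite /beforeb big_split_ord oddI_xor /=; congr (_ (+) _); apply: eq_bigr => l _.
  by rewrite /tpar tnth_cat_l (leq_trans (ltn_ord l)) ?leq_addr.
by rewrite /tpar tnth_cat_r ltn_add2l.
Qed.

Definition theta_sign N (L : N.-tuple letter) : bool := odd (alphaL L) (+) oddI L.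

(** The sign identity behind the invariance of theta-hat. The reversal of positions inverts every
    pair, so [alphaL] is an inversion count and [invb_flip] gives its change. *)
Lemma theta_sign_replace N (L : N.-tuple letter) k b :
  theta_sign (replace L k b) (+) (parE (tnth L k) b && oddI (replace L k b)) =
  theta_sign L (+) (parE (tnth L k) b && par (tnth L k)).
Proof.
have aE (M : N.-tuple letter) : odd (alphaL M) = invb (perm rev_ord_inj) (tpar M).
  rewrite /alphaL -sum1_card big_mkcond odd_sum /invb pair_big /=.
  apply: eq_bigr => -[i j] _; rewrite inE !permE /=.
  have -> : (N - j.+1 < N - i.+1)%N = (i < j)%N.
    by rewrite ltn_sub2lE.
  by case: (i < j)%N; rewrite /tpar //=; case: par; case: par.
have oE := oddI_replace L k b.
rewrite /theta_sign !aE (@invb_flip _ _ (tpar L) _ k) => [|i ne]; last first.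
  by rewrite /tpar tnth_replace (negPf ne).
set B1 := beforeb _ k; set B2 := beforeb _ (_ k).
have B2E : B2 = \big[addb/false]_(l : 'I_N) ((k < l)%N && tpar L l).
  rewrite /B2 /beforeb (reindex_inj rev_ord_inj) permE; apply: eq_bigr => l _.
  have -> : ((perm rev_ord_inj)^-1)%g (rev_ord l) = l.
    by apply: (@perm_inj _ (perm rev_ord_inj)); rewrite permKV permE.
  by rewrite /= ltn_sub2lE.
have B12 : B1 (+) B2 = oddI L (+) tpar L k.
  rewrite -(xor_pick k (fun l => tpar L l)) oddI_xor B2E /B1 /beforeb -!big_split.
  apply: eq_bigr => l _ /=.
  have [->|lk] := eqVneq l k; first by rewrite ltnn; case: tpar.
  by rewrite (ltn_ordN lk); case: (l < k)%N; case: tpar.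
rewrite B12 /tpar tnth_replace eqxx (addbC (par b)) -/(parE _ b) oE.
by case: parE; case: par; case: (invb _ _); case: (oddI L).
Qed.

End Concatenation.

(** * The letters of [Ih] and [Jh] *)

Section BerezinianSequences.
Variables (n m h : nat).
Notation letter := (idx n m).
Implicit Types (a : letter).

Lemma nth_flatten_nseq (T : Type) (x0 : T) (s : seq T) k l :
  (l < k * size s)%N -> nth x0 (flatten (nseq k s)) l = nth x0 s (l %% size s).
Proof.
elim: k l => [|k IH] l //= lk; rewrite nth_cat; case: ltnP => [ls|sl].
  by rewrite modn_small.
rewrite IH; last by rewrite ltn_subLR // -mulSn.
by rewrite -[in RHS](subnK sl) modnDr.
Qed.

Lemma nth_flatten_map_nseq (S T : Type) (x0 : S) (y0 : T) (f : S -> T) (s : seq S) k l :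
  (l < k * size s)%N ->
  nth y0 (flatten [seq nseq k (f x) | x <- s]) l = f (nth x0 s (l %/ k)).
Proof.
elim: s l => [|x s IH] l /=; first by rewrite muln0.
rewrite nth_cat size_nseq mulnS => lk; case: ltnP => [lk'|kl].
  by rewrite nth_nseq lk' divn_small.
have k_gt0 : (0 < k)%N by case: k kl lk {IH} => //; rewrite !mul0n.
rewrite IH ?ltn_subLR // -[in RHS](subnK kl) divnDr ?dvdnn // divnn k_gt0 addn1.
by [].
Qed.

Lemma tnth_Ih (l : 'I_(h * n)) (c : 'I_n) : (l %% n)%N = c -> tnth (Ih n m h) l = inl c.
Proof.
move=> lc; rewrite (tnth_nth (inl c)) /= /Ih_seq nth_flatten_nseq; last first.
  by rewrite size_map size_enum_ord.
by rewrite size_map size_enum_ord lc (nth_map c) ?size_enum_ord // nth_ord_enum.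
Qed.

Lemma tnth_Jh (l : 'I_(h * m)) (d : 'I_m) : (l %/ h)%N = d -> tnth (Jh n m h) l = inr d.
Proof.
move=> ld; rewrite (tnth_nth (inr d)) /= /Jh_seq (nth_flatten_map_nseq d).
  by rewrite ld nth_ord_enum.
by rewrite size_enum_ord.
Qed.

Lemma Ih_even (l : 'I_(h * n)) : par (tnth (Ih n m h) l) = false.
Proof.
have n_gt0 : (0 < n)%N by case: n l => //; rewrite muln0 => -[].
by rewrite (@tnth_Ih l (Ordinal (ltn_pmod l n_gt0))).
Qed.

Lemma Jh_odd (l : 'I_(h * m)) : par (tnth (Jh n m h) l).
Proof.
have h_gt0 : (0 < h)%N by case: h l => // -[].
have hl : (l %/ h < m)%N by rewrite ltn_divLR // (mulnC m).
by rewrite (@tnth_Jh l (Ordinal hl)).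
Qed.

(** Together with [count_Jh], the origin of the scalar [h] by which diagonal matrix units act. *)
Lemma count_Ih a : (count_mem a (Ih n m h) : nat) = if par a then 0 else h.
Proof.
rewrite /= /Ih_seq count_flatten map_nseq sumn_nseq count_map.
case: a => [c|d] /=; last by rewrite (eq_count (a2 := pred0)) ?count_pred0.
by rewrite (eq_count (a2 := pred1 c)) // count_uniq_mem ?enum_uniq // mem_enum mul1n.
Qed.

Lemma count_Jh a : (count_mem a (Jh n m h) : nat) = if par a then h else 0.
Proof.
rewrite /= /Jh_seq count_flatten -map_comp.
case: a => [c|d] /=.
  rewrite (eq_map (g := fun=> 0%N)) => [|j /=]; last by rewrite count_nseq.
  by elim: (enum _).
rewrite sumnE big_map big_enum (bigD1 d) //= count_nseq /= eqxx mul1n big1 ?addn0 // => j jd.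
by rewrite count_nseq /= (inj_eq inr_inj) (negPf jd).
Qed.

End BerezinianSequences.

(** * Invariance of the element under sl(V) *)

Section ThetaInvariant.
Variables (R : fieldType) (n m h : nat).
Hypothesis charR0 : [pchar R]%R =i pred0.
Local Open Scope ring_scope.
Notation letter := (idx n m).
Implicit Types (a b c d : letter).
Notation Ih := (Ih n m h).
Notation Jh := (Jh n m h).
Notation theta := (@theta_elt R n m h).

Definition Ys (K I : (h * n + n * m).-tuple letter) : R :=
  youngE (@row_s n m h) (@col_s n m h) (delta R K) I.
Definition Yt (K J : (n * m + h * m).-tuple letter) : R :=
  youngE' (@row_t n m h) (@col_t n m h) (delta R K) J.

Lemma thetaE I J :
  theta I J = \sum_L (-1) ^+ theta_sign L * Ys (cat_tuple Ih L) I * Yt (cat_tuple L Jh) J.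
Proof.
by apply: eq_bigr => L _; rewrite -signr_odd oddD.
Qed.

Lemma oddI_Ih : oddI Ih = false.
Proof.
by rewrite oddI_xor big1 // => l _; rewrite /tpar Ih_even.
Qed.

Lemma count_cat_Ih N (L : N.-tuple letter) :
  count (@par n m) (cat_tuple Ih L) = count (@par n m) L.
Proof.
rewrite /= count_cat (_ : count _ (Ih_seq n m h) = 0%N) //.
apply/eqP; rewrite -leqn0 leqNgt -has_count; apply/hasPn => x /(tnthP Ih)[l ->].
by rewrite Ih_even.
Qed.

Lemma count_cat_Jh N (L : N.-tuple letter) :
  count (@par n m) (cat_tuple L Jh) = (count (@par n m) L + h * m)%N.
Proof.
rewrite /= count_cat; congr (_ + _)%N; rewrite -[RHS](eqP (size_Jh n m h)).
by apply/eqP; rewrite -all_count; apply/allP => x /(tnthP Jh)[l ->]; rewrite Jh_odd.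
Qed.

(** Young operators preserve the number of odd letters and [Ih] is even, so [oddI I] agrees with
    [oddI L] wherever [Ys] is nonzero. *)
Lemma Ys_twist L I e e' :
  (-1) ^+ (e && oddI I) * Ys (cat_tuple Ih L) I * (-1) ^+ (e && (oddI L (+) e')) =
  Ys (cat_tuple Ih L) I * (-1) ^+ (e && e').
Proof.
have [eqc|neq] := eqVneq (count (@par n m) I) (count (@par n m) (cat_tuple Ih L)); last first.
  by rewrite /Ys youngE_delta_supp // mulr0 !mul0r.
rewrite [X in X * _]mulrC -mulrA -signr_addb; congr (_ * (-1) ^+ nat_of_bool _).
by rewrite /oddI eqc count_cat_Ih -/(oddI L); case: e => //=; rewrite addKb.
Qed.

Lemma D_Ys a b L I :
  D b a (Ys (cat_tuple Ih L)) I =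
  \sum_(k | tnth Ih k == a) Ys (cat_tuple (replace Ih k b) L) I +
  \sum_(k | tnth L k == a) (-1) ^+ (parE a b && beforeb (tpar L) k) *
     Ys (cat_tuple Ih (replace L k b)) I.
Proof.
rewrite /Ys D_youngE_delta big_split_ord /= (_ : parE b a = parE a b); last exact: addbC.
congr (_ + _); apply: eq_big => k; rewrite ?tnth_cat_l ?tnth_cat_r // => _.
  rewrite replace_cat_l beforeb_cat_l {1}/beforeb big1 ?andbF ?mul1r // => l _.
  by rewrite /tpar Ih_even andbF.
by rewrite replace_cat_r beforeb_cat_r oddI_Ih.
Qed.

Lemma D_Yt a b L J :
  D a b (Yt (cat_tuple L Jh)) J =
  \sum_(k | tnth L k == b) (-1) ^+ (parE a b && beforeb (tpar L) k) *
     Yt (cat_tuple (replace L k a) Jh) J +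
  \sum_(k | tnth Jh k == b) (-1) ^+ (parE a b && (oddI L (+) beforeb (tpar Jh) k)) *
     Yt (cat_tuple L (replace Jh k a)) J.
Proof.
rewrite /Yt D_youngE'_delta big_split_ord /=.
congr (_ + _); apply: eq_big => k; rewrite ?tnth_cat_l ?tnth_cat_r // => _.
  by rewrite replace_cat_l beforeb_cat_l.
by rewrite replace_cat_r beforeb_cat_r.
Qed.

(* The middle factor is the canonical invariant of [V^* (x) V], so only the
   letters of [I_h] and [J_h] are moved. *)
Lemma Etot_theta a b I J :
  Etot a b theta I J =
  - (-1) ^+ (parE a b && par a) *
    (\sum_L (-1) ^+ theta_sign L * Yt (cat_tuple L Jh) J *
       \sum_(k | tnth Ih k == a) Ys (cat_tuple (replace Ih k b) L) I) +
  \sum_L (-1) ^+ theta_sign L * Ys (cat_tuple Ih L) I *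
    \sum_(k | tnth Jh k == b) (-1) ^+ (parE a b && beforeb (tpar Jh) k) *
       Yt (cat_tuple L (replace Jh k a)) J.
Proof.
have arr (x t y s z : R) : x * (t * y * (s * z)) = t * (x * y * s * z).
  by rewrite -!mulrA mulrCA.
rewrite /Etot.
rewrite (eq_D _ _ (T' := fun I => \sum_L ((-1) ^+ theta_sign L * Yt (cat_tuple L Jh) J)
   * Ys (cat_tuple Ih L) I)) => [|I']; last first.
  by rewrite thetaE; apply: eq_bigr => L _; rewrite mulrAC.
rewrite (eq_D _ _ (T' := fun J => \sum_L ((-1) ^+ theta_sign L * Ys (cat_tuple Ih L) I)
   * Yt (cat_tuple L Jh) J)) => [|J']; last by rewrite thetaE.
rewrite !D_sum.
under eq_bigr do rewrite DZ D_Ys mulrDr.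
under [X in _ + _ * X = _]eq_bigr do rewrite DZ D_Yt mulrDr.
rewrite !big_split /= !mulrDr -addrA; congr (_ + _).
have tw L e e' := Ys_twist L I e e'.
move: (Ys) (Yt) tw => ys yt tw.
rewrite addrA [X in X + _ = _](_ : _ = 0) ?add0r.
  rewrite mulr_sumr; apply: eq_bigr => L _; rewrite !mulr_sumr.
  apply: eq_bigr => k _.
  by rewrite arr tw -!mulrA.
(* It remains to cancel the moves inside [L] on the two sides. *)
apply/eqP; rewrite mulNr addrC subr_eq0; apply/eqP.
transitivity (\sum_(k < n * m) \sum_(L | tnth L k == b)
   ((-1) ^+ theta_sign L * (-1) ^+ (parE a b && (oddI L (+) beforeb (tpar L) k)))
    * (ys (cat_tuple Ih L) I * yt (cat_tuple (replace L k a) Jh) J)).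
  rewrite (exchange_big_dep xpredT) //= mulr_sumr; apply: eq_bigr => L _.
  rewrite !mulr_sumr; apply: eq_bigr => k _.
  have := tw L (parE a b) (oddI L (+) beforeb (tpar L) k); rewrite addKb arr => ->.
  by rewrite -!mulrA; congr (_ * _); rewrite mulrCA.
rewrite [RHS]mulr_sumr; under [RHS]eq_bigr do rewrite !mulr_sumr.
rewrite [RHS](exchange_big_dep xpredT) //=; apply: eq_bigr => k _.
(* Changing [a] to [b] at [k] on the [V^*] side is paired with changing [b] to [a] at [k] on the [V]
   side; [theta_sign_replace] compares the signs. *)
rewrite (reindex_onto (fun L => replace L k b) (fun M => replace M k a)) /=;
  last by move=> M /eqP <-; rewrite replace_replace replace_id.
apply: eq_big => [L|L /andP[_ /eqP eL]].
  rewrite tnth_replace !eqxx replace_replace /=.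
  by apply/eqP/eqP => [<-|<-]; rewrite ?tnth_replace ?eqxx ?replace_id.
have Lk : tnth L k = a by rewrite -eL tnth_replace eqxx.
have arr2 (x t y s z : R) : x * (t * y * (s * z)) = t * x * s * (z * y).
  by rewrite -!mulrA mulrCA (mulrCA y) (mulrC y).
rewrite eL beforeb_replace ltnn addbF arr2 -!signr_addb.
congr ((-1) ^+ nat_of_bool _ * _); have := theta_sign_replace L k b; rewrite Lk.
by case: parE => /= H; rewrite ?addbA H ?addbF.
Qed.

Lemma sum_count N (K : N.-tuple letter) a (x : R) :
  \sum_(k | tnth K k == a) x = (count_mem a K)%:R * x.
Proof.
rewrite -sum1_count big_tuple natr_sum mulr_suml.
by apply: eq_bigr => k _; rewrite mul1r.
Qed.

(** Replacing a letter by itself only counts it: [h] times in [Ih] if [a] is even, [h] times in [Jh]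
    if [a] is odd. *)
Lemma Etot_theta_diag a I J :
  Etot a a theta I J = - (-1) ^+ par a * h%:R * theta I J.
Proof.
rewrite Etot_theta /parE addbb /= mulN1r thetaE !mulr_sumr -sumrN -big_split.
apply: eq_bigr => L _ /=.
rewrite (eq_bigr (fun=> Ys (cat_tuple Ih L) I)) => [|k /eqP <-]; last by rewrite replace_id.
rewrite sum_count count_Ih.
rewrite (eq_bigr (fun=> Yt (cat_tuple L Jh) J)) => [|k /eqP <-]; last by rewrite replace_id mul1r.
rewrite sum_count count_Jh.
case: (par a); rewrite /= ?expr1 ?opprK ?mul0r ?mulr0 ?oppr0 ?add0r ?addr0 ?mul1r.
  by rewrite mulrCA.
by rewrite mulN1r mulNr; congr (- _); rewrite mulrCA mulrAC.
Qed.

Lemma Ys_replace_eq0 k b L I : ~~ par b -> tnth Ih k != b ->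
  Ys (cat_tuple (replace Ih k b) L) I = 0.
Proof.
case: b => // c _ ne.
have n_gt0 : (0 < n)%N by apply: leq_ltn_trans (ltn_ord c).
(* Each block of [n] entries of [Ih] is a column of [s_1] containing all even letters; this is the
   place of [c] in the block of [k]. *)
have jlt : (k %/ n * n + c < h * n)%N.
  have kn : (k %/ n < h)%N by rewrite ltn_divLR.
  have : ((k %/ n).+1 * n <= h * n)%N by rewrite leq_mul2r kn orbT.
  by apply: leq_trans; rewrite mulSnr ltn_add2l.
have Ihj : tnth Ih (Ordinal jlt) = inl c by apply: tnth_Ih; rewrite /= modnMDl modn_small.
have kj : k != Ordinal jlt by apply: contraNneq ne => ->; rewrite Ihj.
apply: (@youngE_delta_eq0 _ _ _ charR0 _ _ _ _ _
          (lshift (n * m) k) (lshift (n * m) (Ordinal jlt))).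
- by rewrite eq_lshift.
- by rewrite /col_s /= ltn_ord jlt divnMDl // (divn_small (ltn_ord c)) addn0.
- by rewrite !tnth_cat_l !tnth_replace eqxx eq_sym (negPf kj) Ihj.
- by rewrite tnth_cat_l tnth_replace eqxx.
Qed.

Lemma Yt_replace_eq0 k a L J : par a -> tnth Jh k != a ->
  Yt (cat_tuple L (replace Jh k a)) J = 0.
Proof.
case: a => // d _ ne.
have h_gt0 : (0 < h)%N by case: h k {ne} => // -[].
(* The place of the odd letter [d] in the row of [t_2] containing [k]. *)
have jlt : (d * h + k %% h < h * m)%N.
  rewrite mulnC -ltn_subRL -mulnBr (leq_trans (ltn_pmod k h_gt0)) // leq_pmulr //.
  by rewrite subn_gt0.
have Jhj : tnth Jh (Ordinal jlt) = inr d.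
  by apply: tnth_Jh; rewrite /= divnMDl // divn_small ?addn0 // ltn_pmod.
have kj : k != Ordinal jlt by apply: contraNneq ne => ->; rewrite Jhj.
apply: (@youngE'_delta_eq0 _ _ _ charR0 _ _ _ _ _
          (rshift (n * m) k) (rshift (n * m) (Ordinal jlt))).
- by rewrite eq_rshift.
- by rewrite /row_t /= !ltnNge !leq_addr /= !addKn modnMDl modn_mod.
- by rewrite !tnth_cat_r !tnth_replace eqxx eq_sym (negPf kj) Jhj.
- by rewrite tnth_cat_r tnth_replace eqxx.
Qed.

(** A move in [Ih] requires [a] even, hence [b] even; a move in [Jh] requires [b] odd, hence [a]
    odd. Either way a letter is repeated in a column of [s_1] or a row of [t_2]. *)
Lemma Etot_theta_offdiag a b I J : a != b -> par a || ~~ par b ->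
  Etot a b theta I J = 0.
Proof.
move=> ab pab; rewrite Etot_theta !big1 ?mulr0 ?addr0 // => L _.
  rewrite big1 ?mulr0 // => k /eqP Jk; rewrite Yt_replace_eq0 ?mulr0 ?Jk 1?eq_sym //.
  by move: pab; rewrite -Jk Jh_odd orbF.
rewrite big1 ?mulr0 // => k /eqP Ik; rewrite Ys_replace_eq0 ?Ik //.
by move: pab; rewrite -Ik Ih_even.
Qed.

Lemma theta_row_symmetric J : row_symmetric (@row_s n m h) (fun I => theta I J).
Proof.
move=> s ss I; rewrite pactE !thetaE mulr_sumr; apply: eq_bigr => L _.
rewrite mulrA mulrCA -pactE; congr (_ * _ * _).
exact: youngE_row_symmetric.
Qed.

Lemma theta_col_alternating I : col_alternating (@col_t n m h) (theta I).
Proof.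
move=> s ss J; rewrite pactE !thetaE !mulr_sumr; apply: eq_bigr => L _.
rewrite mulrCA -pactE [RHS]mulrCA; congr (_ * _).
exact: youngE'_col_alternating.
Qed.

(** Both Young operators preserve the number of odd letters; [Ih] adds none to those of [L], and
    [Jh] adds [h * m]. *)
Lemma theta_supp (I : (h * n + n * m).-tuple letter)
    (J : (n * m + h * m).-tuple letter) :
  count (@par n m) J != (count (@par n m) I + h * m)%N -> theta I J = 0.
Proof.
move=> neq; rewrite thetaE big1 // => L _.
have [eI|neI] := eqVneq (count (@par n m) I) (count (@par n m) (cat_tuple Ih L)); last first.
  by rewrite /Ys youngE_delta_supp // mulr0 mul0r.
rewrite /Yt youngE'_delta_supp ?mulr0 // count_cat_Jh.
by rewrite eI count_cat_Ih in neq.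
Qed.

(** [E_ab] either creates an odd letter among the [V^*]-factors or removes one among the
    [V]-factors, which shifts the balance of [theta_supp] by one in both cases. *)
Lemma Etot_theta_supp a b (I : (h * n + n * m).-tuple letter)
    (J : (n * m + h * m).-tuple letter) :
  ~~ par a -> par b ->
  (count (@par n m) J).+1 != (count (@par n m) I + h * m)%N -> Etot a b theta I J = 0.
Proof.
move=> pa pb neq; rewrite /Etot /D !big1 ?mulr0 ?addr0 // => k /eqP xk;
  rewrite theta_supp ?mulr0 //; apply: contraNneq neq => eqc.
  have := count_replace J k b; rewrite xk (negPf pa) pb addn0 addn1 => <-.
  by rewrite eqc.
have := count_replace I k a; rewrite xk (negPf pa) pb addn0 addn1 => <-.
by rewrite eqc addSn.
Qed.

Lemma col_t_lt (l : 'I_(n * m + h * m)) : (col_t l < m)%N.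
Proof.
rewrite /col_t; case: (ltnP l (n * m)) => lt.
  have n_gt0 : (0 < n)%N by move: (nat_of_ord l) lt => x; case: (n).
  by rewrite ltn_divLR // (mulnC m).
have h_gt0 : (0 < h)%N.
  move: (nat_of_ord l) (ltn_ord l) lt => x; case: (h) => //.
  by rewrite mul0n addn0 ltnNge => /negPf ->.
by rewrite ltn_divLR // ltn_subLR // (mulnC m).
Qed.

(** Pigeonhole: more than [n * m] even letters cannot occupy distinct pairs of a column and an even
    letter, so some column repeats one. *)
Lemma few_odd_eq0 (T : (n * m + h * m).-tuple letter -> R)
    (J : (n * m + h * m).-tuple letter) :
  col_alternating (@col_t n m h) T -> (count (@par n m) J < h * m)%N -> T J = 0.
Proof.
move=> Tc cJ; pose A := [set l | ~~ par (tnth J l)].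
pose f l := (Ordinal (col_t_lt l), tnth J l).
have cA : (n * m < #|A|)%N.
  have : (#|A| + count (@par n m) J = n * m + h * m)%N.
    rewrite -[RHS](card_ord) -(cardsC A); congr (_ + _)%N.
    rewrite -sum1_count big_tuple -sum1_card; apply: eq_bigl => l.
    by rewrite !inE negbK.
  by rewrite -(ltn_add2r (h * m)); move: #|A| => x <-; rewrite ltn_add2l.
case: (boolP (dinjectiveb f A)) => [/dinjectiveP finj|/dinjectivePn]; last first.
  case=> x Ax [y /andP[/= yx Ay] [cxy Jxy]].
  apply: (col_alternating_eq0 charR0 Tc (i := x) (j := y)) => //; first by rewrite eq_sym.
  by move: Ax; rewrite inE.
have : (#|f @: A| <= #|[set: 'I_m * 'I_n]|)%N.
  apply: leq_trans (leq_imset_card (fun p => (p.1, inl p.2 : letter)) _).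
  apply: subset_leq_card; apply/subsetP => _ /imsetP[l Al ->].
  move: Al; rewrite inE /f; case: (tnth J l) => // c _.
  by apply/imsetP; exists (Ordinal (col_t_lt l), c).
by rewrite card_in_imset // cardsT card_prod !card_ord (mulnC m) leqNgt cA.
Qed.

Lemma Etot_theta_raise a b (I : (h * n + n * m).-tuple letter)
    (J : (n * m + h * m).-tuple letter) :
  ~~ par a -> par b -> Etot a b theta I J = 0.
Proof.
move=> pa pb; move eqk: (count (@par n m) I) => k.
elim: k I eqk J => [|k IH] I eqk J.
  (* With no odd letter in [I], the support condition leaves only sequences [J] having one odd
     letter fewer than [h * m]. *)
  have [cJ|] := eqVneq (count (@par n m) J).+1 (h * m)%N; last first.
    by move=> ne; rewrite Etot_theta_supp ?eqk.
  apply: (few_odd_eq0 (col_alternating_Etot a b theta_col_alternating I)).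
  by rewrite cJ.
have n_gt0 : (0 < n)%N by case: (a) pa => // c _; apply: leq_ltn_trans (ltn_ord c).
have row_lt l : (@row_s n m h l < n)%N by rewrite /row_s; case: ifP; rewrite ltn_pmod.
apply: (@row_symmetric_killed_eq0 R n m charR0 _ (fun l => Ordinal (row_lt l))
          (fun I => Etot a b theta I J) k.+1) => //.
  exact: row_symmetric_Etot theta_row_symmetric J.
move=> c d I1 [eI1].
have low0 I2 J2 : Etot (inr d) (inl c) theta I2 J2 = 0 by apply: Etot_theta_offdiag.
have : Etot (inr d) (inl c) (Etot a b theta) I1 J = 0.
  rewrite Etot_lower_raise //.
  (* If both brackets are diagonal, their scalars [-h] and [h] cancel; otherwise each surviving
     bracket is off-diagonal within one parity. *)
  have [eb|neb] := eqVneq (inr d) b; have [ea|nea] := eqVneq a (inl c).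
  - rewrite -eb ea !Etot_theta_diag !mul1r -!mulrA -mulrDl /=.
    by rewrite expr1 opprK expr0 addrC subrr mul0r.
  - by rewrite (@Etot_theta_offdiag a) ?mulr0 ?mul0r ?addr0 ?orbT.
  - by rewrite (@Etot_theta_offdiag (inr d) b) ?mulr0 ?mul0r ?addr0.
  - by rewrite !mul0r addr0.
(* The part acting on the [V]-factors keeps [I1], which has only [k] odd letters, so it vanishes by
   induction and the [V^*] part vanishes too. *)
rewrite {1}/Etot /= expr1 opprK mul1r => /eqP; rewrite addr_eq0 => /eqP ->.
by rewrite /D big1 ?mulr0 ?oppr0 // => l _; rewrite IH ?mulr0.
Qed.

End ThetaInvariant.

Theorem theorem3p3 (R : fieldType) (hR : [pchar R]%R =i pred0) (n m h : nat)
  (X : idx n m -> idx n m -> R) (hX : supertrace X = 0%R) :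
  forall (I : (h * n + n * m).-tuple (idx n m)) (J : (n * m + h * m).-tuple (idx n m)),
    glact X (@theta_elt R n m h) I J = 0%R.
Proof.
move=> I J; rewrite glactE.
(* Only the diagonal matrix units survive, and their scalars assemble into [-h] times the supertrace
   of [X]. *)
transitivity (\sum_a - (h%:R * theta_elt R I J) * ((-1) ^+ par a * X a a))%R.
  apply: eq_bigr => a _; rewrite (bigD1 a) //= big1 ?addr0 => [|b ne].
    rewrite Etot_theta_diag // !mulNr mulrN; congr (- _)%R.
    by rewrite mulrC -!mulrA mulrCA; congr (_ * _)%R; rewrite mulrCA.
  rewrite eq_sym in ne.
  case: (boolP (par a || ~~ par b)) => [pab|]; first by rewrite Etot_theta_offdiag ?mulr0.
  by rewrite negb_or negbK => /andP[pa pb]; rewrite Etot_theta_raise ?mulr0.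
by rewrite -mulr_sumr -/(supertrace X) hX mulr0.
Qed.
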